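(* Let $n\ge 2$. Both pyramidal spaces $P(K)$ and $P(L)$ are homeomorphic to the double mapping cylinder \[SO(n)/A_{n+1}\leftarrow SO(n)/A_n\rightarrow SO(n)/S_n,\] where the maps are dual to (i.e. are the quotient maps induced by) the inclusions $A_{n+1}\leftarrow A_n\rightarrow S_n$.
   Context: $K$ is the $(n-2)$-skeleton of the $n$-simplex and $L$ is the $(n-2)$-skeleton of the $(n+1)$-simplex. For $X=K,L$, $C(X)$ is the space of images of linear embeddings $X\to\mathbb R^n$ (injective and affine on each simplex), topologized as the space of embeddings (a subspace of $(\mathbb R^n)^N$, $N$ the number of vertices) modulo permutations of the vertices. $P(K)\subset C(K)$ consists of the configurations such that: $n$ of the $n+1$ vertices are the vertices of a regular $(n-1)$-simplex $F$ with unit edge length; the remaining vertex (apex) lies on the line perpendicular to $F$ through the barycenter of $F$; the distance of the apex from the barycenter of $F$ is between $0$ and the height of a regular $n$-simplex with unit edges, both values included; and the barycenter of the configuration is at the origin. $P(L)\subset C(L)$ consists of the configurations for which there is a regular $(n-1)$-simplex $F$ of unit edge length, spanned by $n$ of the vertices, such that: one of the two remaining vertices together with $F$ spans a regular $n$-simplex $\Delta$; the other remaining vertex $a$ lies on the line perpendicular to $F$ through the barycenter of $F$, at distance from that barycenter between $0$ and the height of a regular $n$-simplex with unit edges, both values included; if $a$ is contained in $\Delta$, then $a$ lies on the closed segment between the barycenter of $\Delta$ and the barycenter of $F$ (otherwise $a$ lies on the opposite side of $F$ from $\Delta$); and the barycenter of the configuration (average of the $n+2$ vertices) is at the origin. Subgroups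 of $SO(n)$: fix a regular $n$-simplex $\Delta_0\subset\mathbb R^n$ centered at the origin and a facet $F_0$ of it. $A_{n+1}\subset SO(n)$ is the group of orientation-preserving symmetries of $\Delta_0$; $A_n\subset A_{n+1}$ is the subgroup preserving $F_0$. $S_n\subset SO(n)$ is the group of elements of $SO(n)$ that preserve the linear hyperplane parallel to $F_0$ and preserve in it the translate of $F_0$ centered at the origin (odd permutations act by $-1$ on the perpendicular direction); its even elements form the same $A_n$. The double mapping cylinder of $B\xleftarrow{f}A\xrightarrow{g}C$ is $B\sqcup (A\times[0,1])\sqcup C$ with $(a,0)\sim f(a)$ and $(a,1)\sim g(a)$. *)

(* Defs.v *)
From Stdlib Require Import Relation_Operators.
From HB Require Import structures.
From mathcomp Require Import all_boot all_order all_algebra all_fingroup.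
From mathcomp Require Import generic_quotient.
From mathcomp Require Import all_classical all_reals all_analysis.

Set Implicit Arguments.
Unset Strict Implicit.
Unset Printing Implicit Defensive.

Import Order.TTheory GRing.Theory Num.Theory.
Import numFieldNormedType.Exports.

Local Open Scope classical_set_scope.
Local Open Scope ring_scope.
Local Open Scope quotient_scope.

(* T modulo the smallest equivalence relation containing r, with the quotient
   topology. *)

Definition gen_equiv (T : choiceType) (r : T -> T -> Prop) : rel T :=
  fun x y => `[< clos_refl_sym_trans T r x y >].

Lemma gen_equiv_refl (T : choiceType) (r : T -> T -> Prop) :
  reflexive (gen_equiv r).
Proof. by move=> x; apply/asboolP; exact: rst_refl. Qed.

Lemma gen_equiv_sym (T : choiceType) (r : T -> T -> Prop) :
  symmetric (gen_equiv r).
Proof. by move=> x y; apply/asboolP/asboolP; exact: rst_sym. Qed.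

Lemma gen_equiv_trans (T : choiceType) (r : T -> T -> Prop) :
  transitive (gen_equiv r).
Proof.
by move=> y x z /asboolP xy /asboolP yz; apply/asboolP; exact: rst_trans xy yz.
Qed.

Canonical gen_equiv_equiv (T : choiceType) (r : T -> T -> Prop) :=
  EquivRel (gen_equiv r) (gen_equiv_refl r) (gen_equiv_sym r)
    (@gen_equiv_trans T r).

Definition quotient_by (T : topologicalType) (r : T -> T -> Prop) :
    topologicalType :=
  quotient_topology {eq_quot gen_equiv r}.

Definition quotient_proj (T : topologicalType) (r : T -> T -> Prop) (x : T) :
    quotient_by r :=
  \pi_{eq_quot gen_equiv r} x.

Definition quotient_repr (T : topologicalType) (r : T -> T -> Prop)
    (q : quotient_by r) : T :=
  repr (q : {eq_quot gen_equiv r}).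

Definition homeomorphic (X Y : topologicalType) : Prop :=
  exists (f : X -> Y) (g : Y -> X),
    [/\ continuous f, continuous g, cancel f g & cancel g f].

Definition unit_interval (R : realType) : set R := [set t | 0 <= t <= 1].
Arguments unit_interval : clear implicits.

(* None indexes A x [0,1], Some false indexes B, Some true indexes C. *)
Definition dmc_piece (R : realType) (A B C : topologicalType)
    (i : option bool) : topologicalType :=
  match i with
  | None => (A * set_type (unit_interval R))%type
  | Some false => B
  | Some true => C
  end.

Definition dmc_glue (R : realType) (A B C : topologicalType)
    (f : A -> B) (g : A -> C) (x y : {i & dmc_piece R A B C i}) : Prop :=
  exists (a : A) (t : set_type (unit_interval R)),
    x = existT (dmc_piece R A B C) None (a, t) /\
    ((set_val t = 0 /\ y = existT (dmc_piece R A B C) (Some false) (f a)) \/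
     (set_val t = 1 /\ y = existT (dmc_piece R A B C) (Some true) (g a))).

Definition double_mapping_cylinder (R : realType) (A B C : topologicalType)
    (f : A -> B) (g : A -> C) : topologicalType :=
  quotient_by (@dmc_glue R A B C f g).

(* Points of R^n are column vectors, and an N-tuple of points is the n x N
   matrix having them as columns.  The library norm on column vectors is the
   sup norm, hence the separate Euclidean distance. *)

Definition dotv (R : realType) (n : nat) (u v : 'cV[R]_n) : R :=
  (u^T *m v) 0 0.

Definition edist (R : realType) (n : nat) (u v : 'cV[R]_n) : R :=
  Num.sqrt (dotv (u - v) (u - v)).

Definition barycenter (R : realType) (n N : nat) (V : 'M[R]_(n, N))
    (A : {set 'I_N}) : 'cV[R]_n :=
  (#|A|%:R)^-1 *: \sum_(i in A) col i V.

Definition segment (R : realType) (n : nat) (p q : 'cV[R]_n) : set 'cV[R]_n :=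
  [set x : 'cV[R]_n | exists2 t : R, 0 <= t <= 1 & x = (1 - t) *: p + t *: q].

(* The closed face spanned by A of the standard simplex with vertices 'I_N. *)
Definition face (R : realType) (N : nat) (A : {set 'I_N}) : set 'cV[R]_N :=
  [set t : 'cV[R]_N | [/\ forall i, 0 <= t i 0, \sum_i t i 0 = 1 &
               forall i, i \notin A -> t i 0 = 0]].
Arguments face : clear implicits.

Definition hull (R : realType) (n N : nat) (V : 'M[R]_(n, N))
    (A : {set 'I_N}) : set 'cV[R]_n :=
  [set V *m t | t in face R N A].

(* Geometric realization of the d-skeleton of the simplex with N vertices. *)
Definition skeleton (R : realType) (N d : nat) : set 'cV[R]_N :=
  [set t : 'cV[R]_N | exists2 A : {set 'I_N}, (#|A| <= d.+1)%N & face R N A t].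
Arguments skeleton : clear implicits.

(* A map affine on each simplex is determined by the images of the vertices:
   it sends the point with barycentric coordinates t to V *m t. *)
Definition linear_embeddings (R : realType) (n N d : nat) : set 'M[R]_(n, N) :=
  [set V | set_inj (skeleton R N d) (fun t => V *m t)].
Arguments linear_embeddings : clear implicits.

Definition same_up_to_relabelling (R : realType) (n N d : nat)
    (V W : set_type (linear_embeddings R n N d)) : Prop :=
  exists s : 'S_N, set_val W = col_perm s (set_val V).

(* Every permutation of the vertices is an automorphism of a skeleton of a
   simplex, so the whole group 'S_N is divided out. *)
Definition config_space (R : realType) (n N d : nat) : topologicalType :=
  quotient_by (@same_up_to_relabelling R n N d).

Definition config_subset (R : realType) (n N d : nat)
    (P : 'M[R]_(n, N) -> Prop) : set (config_space R n N d) :=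
  [set quotient_proj (@same_up_to_relabelling R n N d) V | V in
    [set V | P (set_val V)]].

Definition affinely_independent (R : realType) (n N : nat) (V : 'M[R]_(n, N))
    (A : {set 'I_N}) : Prop :=
  forall c : 'cV[R]_N, (forall i, i \notin A -> c i 0 = 0) ->
    \sum_i c i 0 = 0 -> V *m c = 0 -> c = 0.

Definition regular_simplex (R : realType) (n N : nat) (ell : R)
    (V : 'M[R]_(n, N)) (A : {set 'I_N}) : Prop :=
  affinely_independent V A /\
  {in A &, forall i j, i != j -> edist (col i V) (col j V) = ell}.

Definition perp_axis (R : realType) (n N : nat) (V : 'M[R]_(n, N))
    (F : {set 'I_N}) : set 'cV[R]_n :=
  [set x : 'cV[R]_n | {in F &, forall i j,
    dotv (x - barycenter V F) (col i V - col j V) = 0}].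

Definition unit_simplex_height (R : realType) (n : nat) (h : R) : Prop :=
  exists (T : 'M[R]_(n, n.+1)) (k : 'I_n.+1),
    regular_simplex 1 T [set: 'I_n.+1]%SET /\
    h = edist (col k T) (barycenter T (~: [set k])%SET).

Definition pyramidalK (R : realType) (n : nat) (V : 'M[R]_(n, n.+1)) : Prop :=
  exists a : 'I_n.+1,
    let F := (~: [set a])%SET in
    [/\ regular_simplex 1 V F,
        perp_axis V F (col a V),
        exists2 h, unit_simplex_height n h &
          0 <= edist (col a V) (barycenter V F) <= h &
        barycenter V [set: 'I_n.+1]%SET = 0].

Definition pyramidalL (R : realType) (n : nat) (V : 'M[R]_(n, n.+2)) : Prop :=
  exists a w : 'I_n.+2, a != w /\
    let F := (~: [set a; w])%SET in
    let Delta := (w |: F)%SET in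
    let b := barycenter V F in
    [/\ regular_simplex 1 V F /\ regular_simplex 1 V Delta,
        perp_axis V F (col a V),
        exists2 h, unit_simplex_height n h & 0 <= edist (col a V) b <= h,
        (hull V Delta (col a V) -> segment (barycenter V Delta) b (col a V)) /\
        (~ hull V Delta (col a V) ->
           dotv (col a V - b) (col w V - b) < 0) &
        barycenter V [set: 'I_n.+2]%SET = 0].

Definition pyramidal_space_K (R : realType) (n : nat) : topologicalType :=
  set_type (@config_subset R n n.+1 (n - 2) (@pyramidalK R n)).

Definition pyramidal_space_L (R : realType) (n : nat) : topologicalType :=
  set_type (@config_subset R n n.+2 (n - 2) (@pyramidalL R n)).

Definition SO (R : realType) (n : nat) : set 'M[R]_n :=
  [set g | g^T *m g = 1%:M /\ \det g = 1].
Arguments SO : clear implicits.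

Definition preserves (R : realType) (n : nat) (g : 'M[R]_n)
    (X : set 'cV[R]_n) : Prop :=
  [set g *m x | x in X] = X.

(* D lists the vertices of a simplex, and k is the vertex opposite to the
   chosen facet. *)

Definition facet (R : realType) (n : nat) (D : 'M[R]_(n, n.+1))
    (k : 'I_n.+1) : set 'cV[R]_n :=
  hull D (~: [set k])%SET.

Definition facet_direction (R : realType) (n : nat) (D : 'M[R]_(n, n.+1))
    (k : 'I_n.+1) : set 'cV[R]_n :=
  [set D *m c | c in [set c : 'cV[R]_n.+1 | c k 0 = 0 /\ \sum_i c i 0 = 0]].

Definition centered_facet (R : realType) (n : nat) (D : 'M[R]_(n, n.+1))
    (k : 'I_n.+1) : set 'cV[R]_n :=
  [set x - barycenter D (~: [set k])%SET | x in facet D k].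

Definition alt_simplex (R : realType) (n : nat) (D : 'M[R]_(n, n.+1)) :
    set 'M[R]_n :=
  [set g | SO R n g /\ preserves g (hull D [set: 'I_n.+1]%SET)].

Definition alt_facet (R : realType) (n : nat) (D : 'M[R]_(n, n.+1))
    (k : 'I_n.+1) : set 'M[R]_n :=
  [set g | alt_simplex D g /\ preserves g (facet D k)].

Definition sym_facet (R : realType) (n : nat) (D : 'M[R]_(n, n.+1))
    (k : 'I_n.+1) : set 'M[R]_n :=
  [set g | [/\ SO R n g, preserves g (facet_direction D k) &
               preserves g (centered_facet D k)]].

(* Left cosets g H. *)
Definition coset_rel (R : realType) (n : nat) (H : set 'M[R]_n)
    (g g' : set_type (SO R n)) : Prop :=
  exists2 h, H h & set_val g' = set_val g *m h.

Definition SO_mod (R : realType) (n : nat) (H : set 'M[R]_n) :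
    topologicalType :=
  quotient_by (coset_rel H).

(* The map g H |-> g H'; it does not depend on the representative when H is
   included in H', by coset_mapE. *)
Definition coset_map (R : realType) (n : nat) (H H' : set 'M[R]_n)
    (q : SO_mod H) : SO_mod H' :=
  quotient_proj (coset_rel H') (quotient_repr q).

Lemma coset_mapE (R : realType) (n : nat) (H H' : set 'M[R]_n)
    (g : set_type (SO R n)) : H `<=` H' ->
  coset_map H' (quotient_proj (coset_rel H) g) = quotient_proj (coset_rel H') g.
Proof.
move=> HH'; apply/eqmodP => /=; apply/asboolP.
have /eqmodP/asboolP :
  \pi_{eq_quot gen_equiv (coset_rel H)}
    (quotient_repr (quotient_proj (coset_rel H) g)) =
  \pi_{eq_quot gen_equiv (coset_rel H)} g by rewrite reprK.
move: (quotient_repr _) => g0; elim=> [x y [h /HH' Hh e]|x|x y _|x y z _ xy _ yz].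
- by apply: rst_step; exists h.
- exact: rst_refl.
- exact: rst_sym.
- exact: rst_trans xy yz.
Qed.

Definition pyramidal_cylinder (R : realType) (n : nat) (D : 'M[R]_(n, n.+1))
    (k : 'I_n.+1) : topologicalType :=
  @double_mapping_cylinder R
    (SO_mod (alt_facet D k)) (SO_mod (alt_simplex D)) (SO_mod (sym_facet D k))
    (@coset_map R n (alt_facet D k) (alt_simplex D))
    (@coset_map R n (alt_facet D k) (sym_facet D k)).

(* Main.v *)
Require Import Defs.
From Stdlib Require Import Relation_Operators.
From mathcomp Require Import all_boot all_order all_algebra all_fingroup.
From mathcomp Require Import generic_quotient ring lra.
From mathcomp Require Import all_classical all_reals all_analysis.

Set Implicit Arguments.
Unset Strict Implicit.
Unset Printing Implicit Defensive.

Import Order.TTheory GRing.Theory Num.Theory.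
Import numFieldNormedType.Exports.
(* The name edist is also used for extended distances. *)
Import Defs.

Local Open Scope classical_set_scope.
Local Open Scope ring_scope.
Local Open Scope quotient_scope.

(** Both pyramidal spaces are orbit spaces of the same kind.  Fix the regular
    simplex E with unit edges obtained by scaling D, and for t in [0,1] let M t be
    a model configuration built from E by moving one point along the axis of the
    facet opposite to the vertex k.  For K the point is the vertex k itself, which
    moves from its initial position (t = 0) to the barycenter of the facet
    (t = 1).  For L it is an additional point, which moves from the barycenter of
    the simplex (t = 0), across the facet, to the mirror image of the vertex k
    (t = 1).  In both cases M t is recentered at the origin.

    Every configuration of the pyramidal space is, up to relabelling, g M t for a
    rotation g and some t ([cone_onto], [bipyramid_onto]).  It determines t, and it
    determines g up to the rotations h for which h M t is a relabelling of M t
    ([cone_fiber], [bipyramid_fiber]).  For t = 0 these are all the rotations of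
    the simplex; for 0 < t < 1 the moving point is recognizable from the mutual
    distances or the norms of the points, so they are the rotations of the simplex
    that preserve the facet; for t = 1 the configuration remembers nothing but the
    facet, up to the reflection in its hyperplane, so they are the rotations
    preserving the centered facet ([cone_stab], [bipyramid_stab]).  Thus
    SO(n) x [0,1] maps onto the pyramidal space and onto the double mapping
    cylinder with the same fibers, and there is a bijection between the two spaces.
    It is continuous on the cylinder because the projection of SO(n) to its cosets
    is open, the cylinder is compact because SO(n) is, and a space of
    configurations modulo relabelling is Hausdorff; so the bijection is a
    homeomorphism ([orbit_space_cylinder]).

    The metric geometry rests on one identity, [equidistant_dot]: on combinations
    of weight zero of points at mutual distance l, the Euclidean product is
    l^2 / 2 times the product of the coefficients.  It gives the Gram matrix of a
    centered regular simplex, hence the fact that any two of them differ by an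
    orthogonal map ([transport_mul]), which can be made a rotation by swapping two
    vertices ([centered_simplex_SO]).  Symmetries of a simplex or of a facet
    permute its vertices because these are the points of the hull farthest from
    the origin ([hull_vertices]). *)

(** * Quotients and mapping cylinders *)

Lemma quotient_projP (T : topologicalType) (r : T -> T -> Prop) (x y : T) :
  quotient_proj r x = quotient_proj r y <-> clos_refl_sym_trans T r x y.
Proof. by split=> [/eqmodP/asboolP|xy]; last by apply/eqmodP/asboolP. Qed.

Lemma quotient_reprK (T : topologicalType) (r : T -> T -> Prop)
    (q : quotient_by r) :
  quotient_proj r (quotient_repr q) = q.
Proof. exact: reprK. Qed.

Lemma quotient_proj_continuous (T : topologicalType) (r : T -> T -> Prop) :
  continuous (quotient_proj r).
Proof. exact: pi_continuous. Qed.

Section Descent.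
Variables (T : topologicalType) (r : T -> T -> Prop).

Lemma clos_rst_invariant (Z : Type) (f : T -> Z) :
  (forall x y, r x y -> f x = f y) ->
  forall x y, clos_refl_sym_trans T r x y -> f x = f y.
Proof.
move=> fr x y; elim=> [{}x {}y|//|{}x {}y _ ->|{}x {}y z _ -> _ ->] //.
exact: fr.
Qed.

Lemma descentE (Z : Type) (f : T -> Z) (x : T) :
  (forall x y, r x y -> f x = f y) ->
  f (quotient_repr (quotient_proj r x)) = f x.
Proof.
move=> fr; apply: clos_rst_invariant fr _ _ _; apply/quotient_projP.
exact: quotient_reprK.
Qed.

Lemma descent_continuous (Z : topologicalType) (f : T -> Z) :
  (forall x y, r x y -> f x = f y) -> continuous f ->
  continuous (f \o @quotient_repr T r).
Proof.
move=> fr cf; apply: (@repr_comp_continuous T {eq_quot gen_equiv r}) => //.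
move=> x y /eqP/eqmodP/asboolP xy; apply/eqP.
exact: clos_rst_invariant fr _ _ xy.
Qed.

End Descent.

Lemma double_mapping_cylinder_lift (R : realType) (A B C Y : topologicalType)
    (f : A -> B) (g : A -> C) (h : A * set_type (unit_interval R) -> Y)
    (hB : B -> Y) (hC : C -> Y) :
  continuous h -> continuous hB -> continuous hC ->
  (forall a t, set_val t = 0 -> h (a, t) = hB (f a)) ->
  (forall a t, set_val t = 1 -> h (a, t) = hC (g a)) ->
  exists2 F : double_mapping_cylinder R f g -> Y, continuous F &
    forall x, F (quotient_proj (@dmc_glue R A B C f g)
                   (existT (dmc_piece R A B C) None x)) = h x.
Proof.
move=> ch chB chC h0 h1.
pose k (i : option bool) : dmc_piece R A B C i -> Y :=
  match i with None => h | Some false => hB | Some true => hC end.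
pose l (x : {i & dmc_piece R A B C i}) : Y := k (projT1 x) (projT2 x).
have kr x y : dmc_glue f g x y -> l x = l y.
  by move=> [a [t [-> [[t0 ->]|[t1 ->]]]]]; [exact: h0|exact: h1].
exists (l \o @quotient_repr _ (@dmc_glue R A B C f g)).
  apply: descent_continuous kr _; apply: (@sigT_continuous _ _ _ k).
  by case=> [[]|].
by move=> x; rewrite /= (descentE _ kr).
Qed.

(** * Compactness and separation *)

Lemma hausdorff_of_separating (R : realType) (Y : topologicalType) :
  (forall x y : Y, x <> y -> exists2 f : Y -> R, continuous f & f x <> f y) ->
  hausdorff_space Y.
Proof.
move=> sep; rewrite open_hausdorff => x y /eqP /sep[f cf /eqP fxy].
have := @Rhausdorff R; rewrite open_hausdorff.
move=> /(_ _ _ fxy)[[U V] /= [xU yV] [oU oV /eqP UV]].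
exists (f @^-1` U, f @^-1` V) => /=.
  by rewrite !inE in xU yV *.
have oc A : open A -> open (f @^-1` A).
  by move=> oA; apply: open_comp => // z _; exact: cf.
split; [exact: oc|exact: oc|].
by rewrite -preimage_setI UV preimage_set0.
Qed.

Lemma compact_hausdorff_homeomorphic (X Y : topologicalType) (f : X -> Y) :
  compact [set: X] -> hausdorff_space Y -> continuous f ->
  injective f -> (forall y, exists x, f x = y) -> homeomorphic Y X.
Proof.
move=> cX hY cf fI /choice[g fg].
have gf : cancel f g by move=> x; apply: fI; rewrite fg.
exists g, f; split => //; apply/continuous_closedP => A cA.
rewrite (_ : g @^-1` A = f @` A).
  apply: compact_closed => //; apply: continuous_compact.
    exact: continuous_subspaceT.
  exact: subclosed_compact cA cX _.
by apply/seteqP; split=> [y Ay|_ [x Ax <-]] /=; [exists (g y)|rewrite gf].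
Qed.

Lemma compact_set_type (X : topologicalType) (A : set X) :
  compact A -> compact [set: set_type A].
Proof.
move=> cA F FF _.
have FA : (set_val @ F) A.
  by apply: (@filterS _ F _ setT) => [x _|]; [exact: set_valP|exact: filterT].
have [x [Ax clx]] := cA _ _ FA.
exists (SigSub (mem_set Ax) : set_type A); split=> // U V FU [_ [/= [W oW <-] Wx WV]].
have FsU : (set_val @ F) (set_val @` U).
  by apply: (@filterS _ F _ U) FU => y Uy; exists y.
have [] := clx _ W FsU.
  by apply: open_nbhs_nbhs; split => //; move: Wx; rewrite /= set_valE.
by move=> _ [[y Uy <-] Wy]; exists y; split => //; exact: WV.
Qed.

(** * Continuity of matrix-valued maps *)

Lemma continuous_into_matrix (T : topologicalType) (R : realType) (m p : nat)
    (f : T -> 'M[R]_(m, p)) :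
  (forall i j, continuous (fun x => f x i j)) -> continuous f.
Proof.
move=> cf x U [P fP PU].
have : \forall y \near x, forall i j, P i j (f y i j).
  by apply: filter_forall => i; apply: filter_forall => j; exact/cf/fP.
by apply: filterS => y; apply: PU.
Qed.

Lemma continuous_entry (T : topologicalType) (R : realType) (m p : nat)
    (f : T -> 'M[R]_(m, p)) i j :
  continuous f -> continuous (fun x => f x i j).
Proof.
by move=> cf x; apply: continuous_comp (cf x) (@coord_continuous _ _ _ i j _).
Qed.

Section RealFunctions.
Variables (R : realType) (T : topologicalType) (I : Type).

Lemma continuous_sumr (r : seq I) (P : pred I) (F : I -> T -> R) :
  (forall i, P i -> continuous (F i)) ->
  continuous (fun x => \sum_(i <- r | P i) F i x).
Proof. by move=> cF; apply: continuous_big => //; exact: add_continuous. Qed.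

Lemma continuous_prodr (r : seq I) (P : pred I) (F : I -> T -> R) :
  (forall i, P i -> continuous (F i)) ->
  continuous (fun x => \prod_(i <- r | P i) F i x).
Proof. by move=> cF; apply: continuous_big => //; exact: mul_continuous. Qed.

End RealFunctions.

Lemma continuous_mulmx (R : realType) (T : topologicalType) (m p q : nat)
    (f : T -> 'M[R]_(m, p)) (g : T -> 'M[R]_(p, q)) :
  continuous f -> continuous g -> continuous (fun x => f x *m g x).
Proof.
move=> cf cg; apply: continuous_into_matrix => i j.
under eq_fun do rewrite mxE.
apply: continuous_sumr => l _ x.
by apply: continuousM; exact: continuous_entry.
Qed.

Lemma continuous_into_set_type (X Y : topologicalType) (A : set Y)
    (f : X -> set_type A) :
  continuous (fun x => set_val (f x)) -> continuous f.
Proof. exact: continuous_comp_initial. Qed.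

Lemma continuous_pair (X Y Z : topologicalType) (f : X -> Y) (g : X -> Z) :
  continuous f -> continuous g -> continuous (fun x => (f x, g x)).
Proof. by move=> cf cg x; apply: (cvg_pair (cf x) (cg x)). Qed.

Lemma set_val_continuous (X : topologicalType) (A : set X) :
  continuous (set_val : set_type A -> X).
Proof. exact: initial_continuous. Qed.

(** * The rotation group and its cosets *)

Lemma SO_entry_le1 (R : realType) (n : nat) (g : 'M[R]_n) (i j : 'I_n) :
  SO R n g -> `|g i j| <= 1.
Proof.
case=> /matrixP/(_ j j) + _; rewrite !mxE eqxx mulr1n (bigD1 i) //= !mxE => e.
rewrite -(expr_le1 (n := 2)) // real_normK ?num_real // -e expr2 lerDl.
by apply: sumr_ge0 => l _; rewrite mxE -expr2 sqr_ge0.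
Qed.

(** SO(n) is closed in the cube of the matrices with entries in [-1, 1], which
    [vec_mx] identifies with a product of intervals. *)
Lemma SO_compact (R : realType) (n : nat) : compact (SO R n).
Proof.
pose S := [set v : 'rV[R]_(n * n) | SO R n (vec_mx v)].
have cvec : continuous (vec_mx : 'rV[R]_(n * n) -> 'M[R]_n).
  apply: continuous_into_matrix => i j; under eq_fun do rewrite mxE.
  exact: coord_continuous.
have -> : SO R n = vec_mx @` S.
  apply/seteqP; split=> [g Sg|_ [v ? <-] //].
  by exists (mxvec g); rewrite /S /= ?mxvecK.
apply: continuous_compact; first exact: continuous_subspaceT.
have box : compact [set v : 'rV[R]_(n * n) | forall l, (`[-1, 1]%classic : set R) (v ord0 l)].
  by apply: (@rV_compact R _ (fun=> `[-1, 1]%classic)) => _; exact: segment_compact.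
apply: subclosed_compact box _; last first.
  move=> v Sv l; case/mxvec_indexP: l => i j /=.
  have := SO_entry_le1 i j Sv; rewrite mxE.
  by rewrite in_itv /= ler_norml.
have -> : S = \bigcap_(l in [set: 'I_n * 'I_n])
     [set v | ((vec_mx v)^T *m vec_mx v) l.1 l.2 = (1%:M : 'M[R]_n) l.1 l.2]
   `&` [set v | \det (vec_mx v) = 1].
  apply/seteqP; split=> [v [h1 h2]|v [h1 h2]].
    by split=> // l _ /=; rewrite h1.
  by split=> //; apply/matrixP => i j; exact: (h1 (i, j)).
have closed_level (f : 'rV[R]_(n * n) -> R) (c : R) :
    continuous f -> closed [set v | f v = c].
  by move=> /continuous_closedP/(_ _ (@closed_eq R c)).
apply: closedI.
  apply: closed_bigI => l _; apply: closed_level.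
  apply: continuous_entry; apply: continuous_mulmx => //.
  apply: continuous_into_matrix => i j; under eq_fun do rewrite mxE.
  exact: (continuous_entry cvec).
apply: closed_level; apply: continuous_sumr => s _ w.
have cp : continuous (fun v : 'rV[R]_(n * n) => \prod_i vec_mx v i (s i)).
  by apply: continuous_prodr => i _; exact: (continuous_entry cvec).
exact: (@continuousM R _ (fun=> (-1) ^+ s) _ w (@cst_continuous _ _ _ w) (cp w)).
Qed.

Section Cosets.
Variables (R : realType) (n : nat).
Implicit Types g : 'M[R]_n.

Lemma SO1 : SO R n 1%:M.
Proof. by split; rewrite ?trmx1 ?mul1mx ?det1. Qed.

Lemma SOM g g' : SO R n g -> SO R n g' -> SO R n (g *m g').
Proof.
move=> [gg dg] [gg' dg']; split; last by rewrite det_mulmx dg dg' mulr1.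
by rewrite trmx_mul mulmxA -(mulmxA _ _ g) gg mulmx1.
Qed.

Lemma SOV g : SO R n g -> SO R n g^T.
Proof. by move=> [/mulmx1C gg dg]; split; rewrite ?trmxK ?det_tr. Qed.

Lemma SO_tr_mul g : SO R n g -> g^T *m g = 1%:M. Proof. by case. Qed.

Lemma SO_mul_tr g : SO R n g -> g *m g^T = 1%:M.
Proof. by move=> [/mulmx1C]. Qed.

Definition SO_rmul (h g : set_type (SO R n)) : set_type (SO R n) :=
  SigSub (mem_set (SOM (set_valP g) (set_valP h))).

Lemma SO_rmul_continuous h : continuous (SO_rmul h).
Proof.
apply: continuous_into_set_type; apply: continuous_mulmx.
  exact: set_val_continuous.
by move=> x; exact: cst_continuous.
Qed.

Variable H : set 'M[R]_n.
Hypothesis H_SO : H `<=` SO R n.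

(** Equivalence under the relation generated by the cosets is witnessed by one
    right translation that moves every element inside its own class; such a
    translation is a homeomorphism. *)
Lemma coset_rel_translation (g g' : set_type (SO R n)) :
  clos_refl_sym_trans _ (coset_rel H) g g' ->
  exists h, g = SO_rmul h g' /\
    forall x, clos_refl_sym_trans _ (coset_rel H) x (SO_rmul h x).
Proof.
have E x y : set_val x = set_val y -> x = y :> set_type (SO R n).
  by rewrite set_valE; exact: val_inj.
have R1 x (h : 'M[R]_n) (Hh : SO R n h) :
    set_val (SO_rmul (SigSub (mem_set Hh)) x) = set_val x *m h by [].
have R2 x h : set_val (SO_rmul h x) = set_val x *m set_val h by [].
elim=> [x y [h Hh e]|x|x y _ [h [-> IH]]|x y z _ [h [-> IH]] _ [k [-> IHk]]].
- have Sh := H_SO Hh; exists (SigSub (mem_set (SOV Sh))); split.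
    by apply: E; rewrite R1 e -mulmxA SO_mul_tr // mulmx1.
  move=> u; apply: rst_sym; apply: rst_step; exists h => //.
  by rewrite R1 -mulmxA SO_tr_mul // mulmx1.
- exists (SigSub (mem_set SO1)); have e u : SO_rmul (SigSub (mem_set SO1)) u = u.
    by apply: E; rewrite R1 mulmx1.
  by split=> [|u]; rewrite e //; exact: rst_refl.
- have Sh := set_valP h; exists (SigSub (mem_set (SOV Sh))).
  have K u : SO_rmul h (SO_rmul (SigSub (mem_set (SOV Sh))) u) = u.
    by apply: E; rewrite R2 R1 -mulmxA SO_tr_mul // mulmx1.
  have K' u : SO_rmul (SigSub (mem_set (SOV Sh))) (SO_rmul h u) = u.
    by apply: E; rewrite R1 R2 -mulmxA SO_mul_tr // mulmx1.
  split=> [|u]; first by rewrite K'.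
  by apply: rst_sym; rewrite -{2}(K u); exact: IH.
- exists (SO_rmul h k); have K u : SO_rmul (SO_rmul h k) u = SO_rmul h (SO_rmul k u).
    by apply: E; rewrite !R2 mulmxA.
  split=> [|u]; first by rewrite K.
  by rewrite K; apply: rst_trans (IHk u) (IH _).
Qed.

(** The saturation of an open set is a union of right translates of it. *)
Lemma coset_proj_open (U : set (set_type (SO R n))) :
  open U -> open (quotient_proj (coset_rel H) @` U).
Proof.
move=> oU; suff : open (quotient_proj (coset_rel H) @^-1`
    (quotient_proj (coset_rel H) @` U)) by [].
rewrite (_ : _ @^-1` _ = \bigcup_(h in [set h | forall x,
    clos_refl_sym_trans _ (coset_rel H) x (SO_rmul h x)]) (SO_rmul h @^-1` U)).
  apply: bigcup_open => h _; apply: open_comp => // x _.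
  exact: SO_rmul_continuous.
apply/seteqP; split=> [x /= [y Uy /quotient_projP/coset_rel_translation[h [yx hh]]]|].
  by exists h; rewrite //= -yx.
move=> x [h hh Ux] /=; exists (SO_rmul h x) => //.
by apply/quotient_projP/rst_sym.
Qed.

(** A product of a quotient map with an identity need not be a quotient map;
    here it is one because the projection to the cosets is open. *)
Lemma coset_descent_continuous (T Y : topologicalType)
    (f : set_type (SO R n) * T -> Y) :
  (forall (g g' : set_type (SO R n)) t,
    coset_rel H g g' -> f (g, t) = f (g', t)) -> continuous f ->
  continuous (fun x : SO_mod H * T => f (quotient_repr x.1, x.2)).
Proof.
move=> fH cf [q t] U /= /cf[[V W] /= [nV nW] VWU].
move: nV; rewrite nbhsE => -[V' [oV' V'q] V'V].
exists (quotient_proj (coset_rel H) @` V', W) => /=.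
  split=> //; apply: (@open_nbhs_nbhs (SO_mod H)).
  split; first exact: coset_proj_open.
  by exists (quotient_repr q) => //; exact: quotient_reprK.
move=> [_ t'] /= [[g V'g <-] Wt'].
suff -> : f (quotient_repr (quotient_proj (coset_rel H) g), t') = f (g, t').
  by apply: (VWU (g, t')); split => //; exact: V'V.
by apply: (descentE (f := fun g : set_type (SO R n) => f (g, t'))) => x y; exact: fH.
Qed.

End Cosets.

(** * Spaces of configurations up to relabelling *)

Section ConfigurationSpace.
Variables (R : realType) (n N d : nat).
Local Notation same := (@same_up_to_relabelling R n N d).

Lemma config_projP (V W : set_type (linear_embeddings R n N d)) :
  quotient_proj same V = quotient_proj same W <->
  exists s : 'S_N, set_val W = col_perm s (set_val V).
Proof.
split=> [/quotient_projP|VW]; last by apply/quotient_projP; exact: rst_step.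
elim=> [//|x|x y _ [s ->]|x y z _ [s ->] _ [s' ->]].
- by exists 1%g; rewrite col_perm1.
- by exists s^-1%g; rewrite -col_permM mulVg col_perm1.
- by exists (s' * s)%g; rewrite col_permM.
Qed.

(** A product over all relabellings, rather than a minimum, so that the gap is a
    polynomial in W; it vanishes exactly on the relabellings of V. *)
Definition relabelling_gap (V W : 'M[R]_(n, N)) : R :=
  \prod_(s : 'S_N) \sum_i \sum_j (W i j - V i (s j)) ^+ 2.

Lemma relabelling_gap_eq0 V W :
  relabelling_gap V W = 0 -> exists s : 'S_N, W = col_perm s V.
Proof.
move=> /eqP; rewrite /relabelling_gap prodf_seq_eq0 => /hasP[s _ /= /eqP W0].
exists s; apply/matrixP => i j; rewrite mxE.
have nneg i' : true -> 0 <= \sum_j (W i' j - V i' (s j)) ^+ 2.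
  by move=> _; apply: sumr_ge0 => *; exact: sqr_ge0.
have /eqP := psumr_eq0P nneg W0 (i := i) isT.
rewrite psumr_eq0 => [/allP/(_ j)|*]; last exact: sqr_ge0.
by rewrite mem_index_enum sqrf_eq0 subr_eq0 => /(_ isT)/eqP.
Qed.

Lemma relabelling_gap0 V : relabelling_gap V V = 0.
Proof.
apply/eqP; rewrite prodf_seq_eq0; apply/hasP; exists 1%g.
  exact: mem_index_enum.
apply/eqP; apply: big1 => i _; apply: big1 => j _.
by rewrite perm1 subrr expr0n.
Qed.

Lemma relabelling_gap_perm V W (s : 'S_N) :
  relabelling_gap V (col_perm s W) = relabelling_gap V W.
Proof.
rewrite /relabelling_gap (reindex_inj (mulgI s)); apply: eq_bigr => s' _.
apply: eq_bigr => i _; rewrite [RHS](reindex_inj (@perm_inj _ s)).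
by apply: eq_bigr => j _; rewrite mxE permM.
Qed.

Lemma relabelling_gap_continuous V : continuous (relabelling_gap V).
Proof.
apply: continuous_prodr => s _; apply: continuous_sumr => i _.
apply: continuous_sumr => j _ W.
apply: (continuous_comp (f := fun W : 'M[R]_(n, N) => W i j - V i (s j))
    (g := fun y : R => y ^+ 2)); last exact: exprn_continuous.
apply: (@continuousB _ _ _ (fun W : 'M[R]_(n, N) => W i j)); last exact: cst_continuous.
exact: coord_continuous.
Qed.

(** The gap to a fixed configuration descends to a continuous function that
    separates its class from any other one. *)
Lemma config_space_hausdorff : hausdorff_space (config_space R n N d).
Proof.
apply: (@hausdorff_of_separating R) => x y xy.
pose V := set_val (quotient_repr x).
pose f (W : set_type (linear_embeddings R n N d)) := relabelling_gap V (set_val W).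
have fI W W' : same W W' -> f W = f W'.
  by move=> [s e]; rewrite /f e relabelling_gap_perm.
exists (f \o @quotient_repr _ same).
  apply: descent_continuous => // W.
  by apply: continuous_comp; [exact: set_val_continuous|exact: relabelling_gap_continuous].
rewrite /= /f relabelling_gap0 => /esym/relabelling_gap_eq0 Vs; apply: xy.
by rewrite -(quotient_reprK x) -(quotient_reprK y); apply/config_projP.
Qed.

Lemma config_subset_hausdorff (P : 'M[R]_(n, N) -> Prop) :
  hausdorff_space (set_type (@config_subset R n N d P)).
Proof.
move=> x y clxy; suff : set_val x = set_val y by rewrite set_valE => /val_inj.
apply: config_space_hausdorff => A B nA nB.
have [z [Az Bz]] := clxy _ _ (set_val_continuous nA) (set_val_continuous nB).
by exists (set_val z).
Qed.

End ConfigurationSpace.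

(** * Orbit spaces that are double mapping cylinders *)

Section Orbits.
Variables (R : realType) (n N d : nat) (P : 'M[R]_(n, N) -> Prop).
Variables (HA HB HC : set 'M[R]_n) (M : R -> 'M[R]_(n, N)).

(** For a family of configurations M t that becomes more symmetric at t = 0 and at
    t = 1, these are meant to be the rotations h for which h M t is a relabelling
    of M t. *)
Definition end_stabilizer (t : R) : set 'M[R]_n :=
  if t == 0 then HB else if t == 1 then HC else HA.

Hypothesis HA_SO : HA `<=` SO R n.
Hypothesis HAB : HA `<=` HB.
Hypothesis HAC : HA `<=` HC.
Hypothesis M_continuous : continuous M.
Hypothesis M_config : forall g t, SO R n g -> unit_interval R t ->
  linear_embeddings R n N d (g *m M t) /\ P (g *m M t).
Hypothesis M_onto : forall V, P V -> exists g t (s : 'S_N),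
  [/\ SO R n g, unit_interval R t & V = col_perm s (g *m M t)].
Hypothesis M_fiber : forall g g' t t' (s : 'S_N),
  SO R n g -> SO R n g' -> unit_interval R t -> unit_interval R t' ->
  g *m M t = col_perm s (g' *m M t') ->
  t = t' /\ exists2 h, end_stabilizer t h & g = g' *m h.
Hypothesis M_stab : forall t h, unit_interval R t -> end_stabilizer t h ->
  exists s : 'S_N, h *m M t = col_perm s (M t).

Local Notation G := (set_type (SO R n)).
Local Notation I := (set_type (unit_interval R)).
Local Notation Y := (set_type (@config_subset R n N d P)).
Local Notation same := (@same_up_to_relabelling R n N d).

Let emb (z : G * I) : set_type (linear_embeddings R n N d) :=
  SigSub (mem_set (M_config (set_valP z.1) (set_valP z.2)).1).

Let embP (z : G * I) : config_subset P (quotient_proj same (emb z)).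
Proof.
exists (emb z) => //; exact: (M_config (set_valP z.1) (set_valP z.2)).2.
Qed.

Let q (z : G * I) : Y := SigSub (mem_set (embP z)).

Let q_continuous : continuous q.
Proof.
have emb_continuous : continuous emb.
  apply: continuous_into_set_type; apply: continuous_mulmx => x.
    by apply: continuous_comp; [exact: cvg_fst|exact: set_val_continuous].
  apply: continuous_comp; last exact: M_continuous.
  by apply: continuous_comp; [exact: cvg_snd|exact: set_val_continuous].
apply: continuous_into_set_type => x.
apply: (@continuous_comp _ _ _ emb (quotient_proj same)).
  exact: emb_continuous.
exact: (@quotient_proj_continuous _ same (emb x)).
Qed.

Let q_eqP (z z' : G * I) : q z = q z' <->
  exists s : 'S_N, set_val z.1 *m M (set_val z.2) =
    col_perm s (set_val z'.1 *m M (set_val z'.2)).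
Proof.
rewrite -[X in _ <-> X]/(exists s : 'S_N, set_val (emb z) = col_perm s (set_val (emb z'))).
rewrite -config_projP; split=> [/(congr1 val) //|e].
by apply: val_inj; rewrite /= e.
Qed.

Let q_stab (g g' : G) (t : I) (h : 'M[R]_n) :
  end_stabilizer (set_val t) h -> set_val g' = set_val g *m h ->
  q (g, t) = q (g', t).
Proof.
move=> /(M_stab (set_valP t))[s hM] g'E; apply/esym/q_eqP; exists s => /=.
by rewrite g'E -mulmxA hM !col_permE mulmxA.
Qed.

Let HA_stab t : HA `<=` end_stabilizer t.
Proof.
by rewrite /end_stabilizer; case: ifP => _; [exact: HAB|case: ifP => _; [exact: HAC|]].
Qed.

Let I0 : unit_interval R 0. Proof. by rewrite /unit_interval /= lexx ler01. Qed.
Let I1 : unit_interval R 1. Proof. by rewrite /unit_interval /= lexx ler01. Qed.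
Let t0 : I := SigSub (mem_set I0).
Let t1 : I := SigSub (mem_set I1).

Local Notation fB := (@coset_map R n HA HB).
Local Notation fC := (@coset_map R n HA HC).
Local Notation cylinder := (double_mapping_cylinder R fB fC).
Local Notation piece :=
  (dmc_piece R (SO_mod HA) (SO_mod HB) (SO_mod HC)).
Local Notation glue := (@dmc_glue R _ _ _ fB fC).

Let p (z : G * I) : cylinder :=
  quotient_proj glue (existT piece None (quotient_proj (coset_rel HA) z.1, z.2)).

Let p_continuous : continuous p.
Proof.
pose k (z : G * I) : SO_mod HA * I := (quotient_proj (coset_rel HA) z.1, z.2).
have ck : continuous k.
  apply: continuous_pair => z; last exact: cvg_snd.
  apply: (@continuous_comp _ _ _ fst (quotient_proj (coset_rel HA))).
    exact: cvg_fst.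
  exact: quotient_proj_continuous.
move=> z; apply: (@continuous_comp _ _ _ k
  (fun u => quotient_proj glue (existT piece None u))); first exact: ck.
apply: (@continuous_comp _ _ _ (existT piece None) (quotient_proj glue)).
  exact: existT_continuous.
exact: quotient_proj_continuous.
Qed.

Let p0 (g : G) (t : I) : set_val t = 0 ->
  p (g, t) = quotient_proj glue
    (existT piece (Some false) (quotient_proj (coset_rel HB) g)).
Proof.
move=> t_0; apply/quotient_projP; apply: rst_step.
exists (quotient_proj (coset_rel HA) g), t; split=> //; left.
by rewrite coset_mapE.
Qed.

Let p1 (g : G) (t : I) : set_val t = 1 ->
  p (g, t) = quotient_proj glue
    (existT piece (Some true) (quotient_proj (coset_rel HC) g)).
Proof.
move=> t_1; apply/quotient_projP; apply: rst_step.
exists (quotient_proj (coset_rel HA) g), t; split=> //; right.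
by rewrite coset_mapE.
Qed.

Let p_onto (x : cylinder) : exists z, p z = x.
Proof.
rewrite -(quotient_reprK x); case: (quotient_repr x) => -[[|]|] /=.
- move=> c; exists (quotient_repr c, t1).
  by rewrite p1 ?quotient_reprK.
- move=> b; exists (quotient_repr b, t0).
  by rewrite p0 ?quotient_reprK.
- by move=> [a t]; exists (quotient_repr a, t); rewrite /p quotient_reprK.
Qed.

Let coset_eq (H : set 'M[R]_n) (g g' : G) h :
  H h -> set_val g = set_val g' *m h ->
  quotient_proj (coset_rel H) g = quotient_proj (coset_rel H) g'.
Proof.
by move=> Hh e; apply/quotient_projP/rst_sym; apply: rst_step; exists h.
Qed.

Let q_p (z z' : G * I) : q z = q z' -> p z = p z'.
Proof.
case: z z' => [g t] [g' t'] /q_eqP[s] /= /M_fiber.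
case=> [||||tt' [h]]; do ?exact: set_valP.
have -> : t' = t by apply: val_inj; move: tt'; rewrite set_valE.
rewrite /end_stabilizer; case: eqP => [t_0 hB gE|_].
  by rewrite !p0 // (coset_eq hB gE).
case: eqP => [t_1 hC gE|_ hA gE]; first by rewrite !p1 // (coset_eq hC gE).
by rewrite /p /= (coset_eq hA gE).
Qed.

(** The maps q and p have the same fibers, so q factors through a bijection F from
    the cylinder; F is continuous, from a compact space to a Hausdorff one. *)
Theorem orbit_space_cylinder : homeomorphic Y cylinder.
Proof.
have q_descends t H : H `<=` end_stabilizer (set_val t) ->
    forall g g', coset_rel H g g' -> q (g, t) = q (g', t).
  by move=> HS g g' [h /HS Hh e]; exact: q_stab Hh e.
have HBt0 (t : I) : set_val t = 0 -> HB `<=` end_stabilizer (set_val t).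
  by move=> t_0; rewrite /end_stabilizer t_0 eqxx.
have HCt1 (t : I) : set_val t = 1 -> HC `<=` end_stabilizer (set_val t).
  by move=> t_1; rewrite /end_stabilizer t_1 oner_eq0 eqxx.
have cq t : continuous (fun g : G => q (g, t)).
  move=> g; apply: (@continuous_comp _ _ _ (fun g : G => (g, t)) q).
    by apply: continuous_pair => g'; [exact: cvg_id|exact: cst_continuous].
  exact: q_continuous.
have dB := q_descends t0 HB (HBt0 t0 erefl).
have dC := q_descends t1 HC (HCt1 t1 erefl).
have dA t := q_descends t HA (@HA_stab _).
have tE (t t' : I) : set_val t = set_val t' -> t = t'.
  by rewrite set_valE; exact: val_inj.
have hAB (a : SO_mod HA) (t : I) : set_val t = 0 -> q (quotient_repr a, t) =
    q (quotient_repr (fB a), t0).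
  move=> t_0; rewrite /coset_map (descentE (f := fun g => q (g, t0)) _ dB).
  by rewrite (tE t t0).
have hAC (a : SO_mod HA) (t : I) : set_val t = 1 -> q (quotient_repr a, t) =
    q (quotient_repr (fC a), t1).
  move=> t_1; rewrite /coset_map (descentE (f := fun g => q (g, t1)) _ dC).
  by rewrite (tE t t1).
have [F cF Fp] := @double_mapping_cylinder_lift R _ _ _ Y fB fC
  (fun x => q (quotient_repr x.1, x.2))
  ((fun g => q (g, t0)) \o @quotient_repr _ (coset_rel HB))
  ((fun g => q (g, t1)) \o @quotient_repr _ (coset_rel HC))
  (coset_descent_continuous HA_SO (fun g g' t => dA t g g') q_continuous)
  (descent_continuous dB (cq t0)) (descent_continuous dC (cq t1)) hAB hAC.
have FpE z : F (p z) = q z.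
  rewrite /p Fp /=; case: z => g t /=.
  exact: (descentE (f := fun g => q (g, t)) _ (dA t)).
apply: (@compact_hausdorff_homeomorphic _ _ F) => //.
- have cZ : compact [set: G * I].
    rewrite -setXTT; apply: compact_setX; apply: compact_set_type.
      exact: SO_compact.
    rewrite (_ : unit_interval R = `[0, 1]%classic); first exact: segment_compact.
    by apply/seteqP; split=> x; rewrite /= in_itv.
  rewrite (_ : [set: cylinder] = p @` [set: G * I]).
    by apply: continuous_compact cZ; exact: continuous_subspaceT.
  by apply/seteqP; split=> // x _; have [z <-] := p_onto x; exists z.
- exact: config_subset_hausdorff.
- move=> x y; have [z <-] := p_onto x; have [z' <-] := p_onto y.
  by rewrite !FpE; exact: q_p.
- move=> y; have := set_valP y => -[V PV projV].
  have [g [t [s [Sg It VE]]]] := M_onto PV.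
  exists (p (SigSub (mem_set Sg), SigSub (mem_set It))); rewrite FpE.
  apply: val_inj; rewrite /= -[RHS]projV; apply/config_projP; exists s.
  by rewrite VE.
Qed.

End Orbits.

(** * The Euclidean product *)

Section Dot.
Variables (R : realType) (n : nat).
Implicit Types u v w : 'cV[R]_n.

Lemma dotvE u v : dotv u v = \sum_i u i 0 * v i 0.
Proof. by rewrite /dotv mxE; apply: eq_bigr => i _; rewrite mxE. Qed.

Lemma dotvC u v : dotv u v = dotv v u.
Proof. by rewrite !dotvE; apply: eq_bigr => i _; rewrite mulrC. Qed.

Lemma dotvDl u v w : dotv (u + v) w = dotv u w + dotv v w.
Proof. by rewrite /dotv linearD mulmxDl mxE. Qed.

Lemma dotvZl a u w : dotv (a *: u) w = a * dotv u w.
Proof. by rewrite /dotv linearZ -scalemxAl mxE. Qed.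

Lemma dotvNl u w : dotv (- u) w = - dotv u w.
Proof. by rewrite -scaleN1r dotvZl mulN1r. Qed.

Lemma dotvBl u v w : dotv (u - v) w = dotv u w - dotv v w.
Proof. by rewrite dotvDl dotvNl. Qed.

Lemma dotvDr u v w : dotv w (u + v) = dotv w u + dotv w v.
Proof. by rewrite !(dotvC w) dotvDl. Qed.

Lemma dotvZr a u w : dotv w (a *: u) = a * dotv w u.
Proof. by rewrite !(dotvC w) dotvZl. Qed.

Lemma dotvNr u w : dotv w (- u) = - dotv w u.
Proof. by rewrite !(dotvC w) dotvNl. Qed.

Lemma dotvBr u v w : dotv w (u - v) = dotv w u - dotv w v.
Proof. by rewrite dotvDr dotvNr. Qed.

Lemma dotv0l w : dotv 0 w = 0.
Proof. by rewrite -(scale0r 0) dotvZl mul0r. Qed.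

Lemma dotv_suml I (r : seq I) (P : pred I) (F : I -> 'cV[R]_n) w :
  dotv (\sum_(i <- r | P i) F i) w = \sum_(i <- r | P i) dotv (F i) w.
Proof.
by elim/big_rec2: _ => [|i x y _ <-]; rewrite ?dotv0l ?dotvDl.
Qed.

Lemma dotv_sumr I (r : seq I) (P : pred I) (F : I -> 'cV[R]_n) w :
  dotv w (\sum_(i <- r | P i) F i) = \sum_(i <- r | P i) dotv w (F i).
Proof.
by rewrite dotvC dotv_suml; apply: eq_bigr => i _; rewrite dotvC.
Qed.

Definition dotv_linear := (dotvDl, dotvDr, dotvNl, dotvNr, dotvZl, dotvZr).

Lemma dotv_ge0 u : 0 <= dotv u u.
Proof. by rewrite dotvE; apply: sumr_ge0 => i _; rewrite -expr2 sqr_ge0. Qed.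

Lemma dotv_eq0 u : dotv u u = 0 -> u = 0.
Proof.
rewrite dotvE => /psumr_eq0P u0; apply/colP => i; rewrite mxE; apply/eqP.
by rewrite -[_ == 0]orbb -mulf_eq0 u0 // => j _; rewrite -expr2 sqr_ge0.
Qed.

Lemma dotv_orthogonal (g : 'M[R]_n) u v :
  g^T *m g = 1%:M -> dotv (g *m u) (g *m v) = dotv u v.
Proof.
by move=> gg; rewrite /dotv trmx_mul mulmxA -(mulmxA _ _ g) gg mulmx1.
Qed.

Lemma edist_sqr u v : edist u v ^+ 2 = dotv (u - v) (u - v).
Proof. by rewrite /edist sqr_sqrtr ?dotv_ge0. Qed.

Lemma edist_ge0 u v : 0 <= edist u v.
Proof. exact: sqrtr_ge0. Qed.

Lemma edist_eq u v a : 0 <= a -> (edist u v = a) <-> (dotv (u - v) (u - v) = a ^+ 2).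
Proof.
move=> a0; rewrite -edist_sqr; split=> [-> //|/eqP].
by rewrite eqrXn2 ?edist_ge0 // => /eqP.
Qed.

End Dot.

Lemma mulmx_cols (R : realType) (m p : nat) (V : 'M[R]_(m, p)) (c : 'cV[R]_p) :
  V *m c = \sum_i c i 0 *: col i V.
Proof.
apply/colP => x; rewrite mxE summxE; apply: eq_bigr => i _.
by rewrite !mxE mulrC.
Qed.

(** * Columns and coefficients *)

Definition of_cols (R : realType) (n N : nat) (f : 'I_N -> 'cV[R]_n) :
  'M[R]_(n, N) := \matrix_(i, j) f j i 0.

Lemma col_of_cols (R : realType) (n N : nat) (f : 'I_N -> 'cV[R]_n) j :
  col j (of_cols f) = f j.
Proof. by apply/colP => x; rewrite !mxE. Qed.

Lemma eq_cols (R : realType) (n N : nat) (V W : 'M[R]_(n, N)) :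
  (forall j, col j V = col j W) -> V = W.
Proof.
by move=> VW; apply/matrixP => x j; have /colP/(_ x) := VW j; rewrite !mxE.
Qed.

Lemma col_mulmx (R : realType) (m p q : nat) (A : 'M[R]_(m, p))
    (B : 'M[R]_(p, q)) j :
  col j (A *m B) = A *m col j B.
Proof. by rewrite !colE mulmxA. Qed.

Lemma col_col_perm (R : realType) (m p : nat) (A : 'M[R]_(m, p)) (s : 'S_p) j :
  col j (col_perm s A) = col (s j) A.
Proof. by apply/colP => x; rewrite !mxE. Qed.

Lemma dot_delta (R : realType) (N : nat) (i : 'I_N) (c : 'cV[R]_N) :
  dotv (delta_mx i 0) c = c i 0.
Proof.
rewrite dotvE (bigD1 i) //= big1 => [|j ji].
  by rewrite mxE !eqxx mul1r addr0.
by rewrite mxE (negPf ji) mul0r.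
Qed.

Lemma sum_delta_mx (R : realType) (N : nat) (k : 'I_N) :
  \sum_i (delta_mx k 0 : 'cV[R]_N) i 0 = 1.
Proof.
rewrite (bigD1 k) //= big1 => [|i ik]; first by rewrite mxE !eqxx addr0.
by rewrite mxE (negPf ik).
Qed.

(** * Equidistant points *)

Definition equidistant (R : realType) (n N : nat) (d2 : R) (V : 'M[R]_(n, N))
    (A : {set 'I_N}) : Prop :=
  {in A &, forall i j, i != j ->
    dotv (col i V - col j V) (col i V - col j V) = d2}.

Section Equidistant.
Variables (R : realType) (n N : nat) (d2 : R) (V : 'M[R]_(n, N)).
Variable A : {set 'I_N}.
Hypothesis V_eq : equidistant d2 V A.

(** Write the product of two points as half the sum of their squared norms minus
    half their squared distance.  The squared norms cancel because the weights
    sum to zero, and all distances are equal off the diagonal. *)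
Lemma equidistant_dot (c d : 'cV[R]_N) :
  (forall i, i \notin A -> c i 0 = 0) -> (forall i, i \notin A -> d i 0 = 0) ->
  \sum_i c i 0 = 0 -> \sum_i d i 0 = 0 ->
  dotv (V *m c) (V *m d) = d2 / 2 * dotv c d.
Proof.
move=> cA dA c0 d0; pose s i := dotv (col i V) (col i V).
have term i j : c i 0 * (d j 0 * dotv (col i V) (col j V)) =
    d j 0 * (c i 0 * s i / 2 - c i 0 * d2 / 2) + c i 0 * (d j 0 * s j / 2) +
    (if j == i then d2 / 2 * (c i 0 * d i 0) else 0).
  have [iA|/cA->] := boolP (i \in A); last by case: ifP; rewrite !(mul0r,mulr0,addr0,subr0).
  have [jA|/dA dj] := boolP (j \in A); last first.
    rewrite dj; case: eqP => [ji|_]; last by rewrite !(mul0r,mulr0,addr0,subr0).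
    by rewrite -ji dj !(mul0r,mulr0,addr0,subr0).
  case: eqVneq => [->|ji]; first by rewrite /s; field.
  have : dotv (col i V) (col j V) = (s i + s j - d2) / 2.
    have := V_eq iA jA; rewrite eq_sym => /(_ ji) <-.
    by rewrite /s !dotv_linear (dotvC (col j V) (col i V)); field.
  by move=> ->; field.
rewrite !mulmx_cols dotv_suml.
under eq_bigr do rewrite dotvZl dotv_sumr mulr_sumr.
under eq_bigr do (under eq_bigr do rewrite dotvZr term).
under eq_bigr do rewrite !big_split /= -mulr_suml d0 mul0r add0r -mulr_sumr
  -big_mkcond big_pred1_eq.
by rewrite big_split /= -mulr_suml c0 mul0r add0r -mulr_sumr dotvE.
Qed.

Lemma equidistant_affinely_independent :
  d2 != 0 -> affinely_independent V A.
Proof.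
move=> d20 c cA c0 Vc; have := equidistant_dot cA cA c0 c0.
rewrite Vc dotv0l => /esym/eqP; rewrite !mulf_eq0 invr_eq0 (negPf d20) pnatr_eq0 /=.
by move=> /eqP/dotv_eq0.
Qed.

End Equidistant.

Lemma regular_simplex1P (R : realType) (n N : nat) (V : 'M[R]_(n, N))
    (A : {set 'I_N}) :
  regular_simplex 1 V A <-> equidistant 1 V A.
Proof.
split=> [[_ VA] i j iA jA ij|VA].
  by have /(edist_eq _ _ ler01) := VA i j iA jA ij; rewrite expr1n.
split; first by apply: equidistant_affinely_independent VA _; exact: oner_neq0.
by move=> i j iA jA ij; apply/(edist_eq _ _ ler01); rewrite expr1n; exact: VA.
Qed.

(** * Centered regular simplices *)

Definition centered_simplex (R : realType) (n : nat) (d2 : R)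
    (W : 'M[R]_(n, n.+1)) : Prop :=
  equidistant d2 W [set: 'I_n.+1]%SET /\ \sum_i col i W = 0.

Section CenteredSimplex.
Variables (R : realType) (n : nat) (d2 : R) (W : 'M[R]_(n, n.+1)).
Hypothesis d2_neq0 : d2 != 0.
Hypothesis W_simplex : centered_simplex d2 W.

Let nS_neq0 : n%:R + 1 != 0 :> R.
Proof. by rewrite natr1 pnatr_eq0. Qed.

(** Subtracting their mean makes the coefficients sum to zero, and does not change
    the point since the vertices sum to zero. *)
Lemma centered_simplex_dot (c d : 'cV[R]_n.+1) :
  dotv (W *m c) (W *m d) =
    d2 / 2 * (dotv c d - (\sum_i c i 0) * (\sum_i d i 0) / n.+1%:R).
Proof.
pose mean (c : 'cV[R]_n.+1) := c - const_mx ((\sum_i c i 0) / n.+1%:R).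
have WE c' : W *m c' = W *m mean c'.
  rewrite mulmxBr [X in _ - X]mulmx_cols.
  under eq_bigr do rewrite mxE.
  by rewrite -scaler_sumr W_simplex.2 scaler0 subr0.
have mean0 c' : \sum_i mean c' i 0 = 0.
  under eq_bigr do rewrite !mxE.
  rewrite sumrB sumr_const card_ord -(mulr_natr (_ / _)) divfK ?subrr //.
rewrite (WE c) (WE d) (equidistant_dot W_simplex.1) //; try by move=> i; rewrite inE.
congr (_ * _); rewrite /mean !dotv_linear.
have dc a c' : dotv (const_mx a) c' = a * \sum_i c' i 0.
  by rewrite dotvE mulr_sumr; apply: eq_bigr => i _; rewrite mxE.
have cd a c' : dotv c' (const_mx a) = a * \sum_i c' i 0 by rewrite dotvC dc.
have sc a : \sum_i (const_mx a : 'cV[R]_n.+1) i 0 = a * (n%:R + 1).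
  by under eq_bigr do rewrite mxE; rewrite sumr_const card_ord natr1 mulr_natr.
rewrite !(dc, cd) sc -natr1; field.
exact: nS_neq0.
Qed.

Lemma centered_simplex_gram i j :
  dotv (col i W) (col j W) = d2 / 2 * ((i == j)%:R - n.+1%:R^-1).
Proof.
rewrite !colE centered_simplex_dot dot_delta !sum_delta_mx !mul1r mxE andbT.
by rewrite eq_sym.
Qed.

Lemma centered_simplex_kernel (c : 'cV[R]_n.+1) :
  W *m c = 0 -> forall i, c i 0 = (\sum_i c i 0) / n.+1%:R.
Proof.
move=> Wc i; have := centered_simplex_dot (delta_mx i 0) c.
rewrite Wc dotvC dotv0l dot_delta => /esym/eqP.
rewrite !mulf_eq0 invr_eq0 pnatr_eq0 (negPf d2_neq0) /= subr_eq0 => /eqP ->.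
by rewrite sum_delta_mx mul1r.
Qed.

Lemma centered_simplex_inj i j : col i W = col j W -> i = j.
Proof.
move=> e; apply/eqP/negPn/negP => ij.
have := W_simplex.1 i j (finset.in_setT i) (finset.in_setT j) ij.
by rewrite e subrr dotv0l => /esym/eqP; rewrite (negPf d2_neq0).
Qed.

(** The vertices form a tight frame: bordered by a constant row, W becomes a square
    matrix U with a left inverse L proportional to W^T apart from its border, and
    L is also a right inverse. *)
Lemma centered_simplex_frame : W *m W^T = (d2 / 2)%:M.
Proof.
pose L : 'M[R]_(n.+1, 1 + n) := row_mx (const_mx 1) W^T.
pose U : 'M[R]_(1 + n, n.+1) := col_mx (const_mx (d2 / 2 / n.+1%:R)) W.
have LU : L *m U = (d2 / 2)%:M.
  rewrite mul_row_col; apply/matrixP => i j; rewrite !mxE big_ord_recl big_ord0.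
  rewrite !mxE mul1r addr0.
  have <- : dotv (col i W) (col j W) = \sum_l W^T i l * W l j.
    by rewrite dotvE; apply: eq_bigr => l _; rewrite !mxE.
  rewrite centered_simplex_gram -mulr_natr; ring.
have : U *m ((d2 / 2)^-1 *: L) = 1%:M.
  apply: mulmx1C; rewrite -scalemxAl LU scale_scalar_mx mulVf //.
  by rewrite mulf_neq0 // invr_eq0 pnatr_eq0.
rewrite -scalemxAr /L /U mul_col_row scale_block_mx (@scalar_mx_block _ 1 n).
move=> /eq_block_mx[_ _ _ /(congr1 ( *:%R (d2 / 2)))].
rewrite scalerA mulfV ?scale1r => [->|]; first by rewrite scale_scalar_mx mulr1.
by rewrite mulf_neq0 // invr_eq0 pnatr_eq0.
Qed.

(** The axis of the facet opposite to k is a line: expand x along the frame, with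
    equal coefficients on the vertices of the facet, which sum to the opposite of
    the vertex k. *)
Lemma centered_simplex_perp k (x : 'cV[R]_n) : (0 < n)%N ->
  (forall i j, i != k -> j != k -> dotv x (col i W - col j W) = 0) ->
  exists a, x = a *: col k W.
Proof.
move=> n0 xW; pose y := W^T *m x.
have yE i : y i 0 = dotv x (col i W).
  by rewrite dotvC dotvE mxE; apply: eq_bigr => l _; rewrite !mxE.
have {}xW i j : i != k -> j != k -> y i 0 = y j 0.
  by move=> ik jk; have := xW i j ik jk; rewrite dotvBr -!yE => /eqP; rewrite subr_eq0 => /eqP.
have [j jk] : exists j, j != k.
  by exists (lift k (Ordinal n0)); rewrite eq_sym neq_lift.
have xE : (d2 / 2) *: x = (y k 0 - y j 0) *: col k W.
  rewrite -mul_scalar_mx -centered_simplex_frame -mulmxA mulmx_cols -/y.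
  rewrite (eq_bigr (fun i => y j 0 *: col i W +
      (if i == k then (y k 0 - y j 0) *: col k W else 0))).
    rewrite big_split /= -scaler_sumr W_simplex.2 scaler0 add0r.
    by rewrite -big_mkcond big_pred1_eq.
  move=> i _; case: eqVneq => [->|ik]; last by rewrite addr0 (xW i j).
  by rewrite -scalerDl addrC subrK.
exists ((d2 / 2)^-1 * (y k 0 - y j 0)); rewrite -scalerA -xE scalerA mulVf ?scale1r //.
by rewrite mulf_neq0 // invr_eq0 pnatr_eq0.
Qed.

End CenteredSimplex.

Section Transport.
Variables (R : realType) (n : nat) (d2 : R).
Hypothesis d2_neq0 : d2 != 0.
Implicit Types (W E : 'M[R]_(n, n.+1)) (g : 'M[R]_n).

Let half_neq0 : d2 / 2 != 0.
Proof. by rewrite mulf_neq0 // invr_eq0 pnatr_eq0. Qed.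

Lemma gram_eq n1 N (V V' : 'M[R]_(n1, N)) :
  (forall i j, dotv (col i V) (col j V) = dotv (col i V') (col j V')) ->
  V^T *m V = V'^T *m V'.
Proof.
have E (U : 'M[R]_(n1, N)) i j : (U^T *m U) i j = dotv (col i U) (col j U).
  by rewrite mxE dotvE; apply: eq_bigr => l _; rewrite !mxE.
by move=> VV'; apply/matrixP => i j; rewrite !E.
Qed.

(** By the frame identity this is the linear map that sends each vertex of E to
    the vertex of W with the same label. *)
Definition transport E W : 'M[R]_n := (d2 / 2)^-1 *: (W *m E^T).

Lemma transport_mul E W : centered_simplex d2 E -> centered_simplex d2 W ->
  transport E W *m E = W.
Proof.
move=> Es Ws; rewrite /transport -scalemxAl -mulmxA.
rewrite (gram_eq (V' := W)); last by move=> i j; rewrite !(@centered_simplex_gram _ _ d2).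
by rewrite mulmxA (centered_simplex_frame d2_neq0 Ws) mul_scalar_mx scalerA mulVf ?scale1r.
Qed.

Lemma transport_orthogonal E W : centered_simplex d2 E -> centered_simplex d2 W ->
  (transport E W)^T *m transport E W = 1%:M.
Proof.
move=> Es Ws.
have -> : (transport E W)^T = (d2 / 2)^-1 *: (E *m W^T).
  by rewrite /transport linearZ /= trmx_mul trmxK.
rewrite /transport -scalemxAl -scalemxAr scalerA mulmxA -(mulmxA E).
rewrite (gram_eq (V := W) (V' := E)); last first.
  by move=> i j; rewrite !(@centered_simplex_gram _ _ d2).
rewrite mulmxA (centered_simplex_frame d2_neq0 Es) -mulmxA.
rewrite (centered_simplex_frame d2_neq0 Es) mul_scalar_mx scale_scalar_mx.
by rewrite scale_scalar_mx mulrACA mulVf // mulr1.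
Qed.

Lemma centered_simplex_mul g W : g^T *m g = 1%:M ->
  centered_simplex d2 W -> centered_simplex d2 (g *m W).
Proof.
move=> gg [We Ws]; split.
  move=> i j iA jA ij; rewrite !col_mulmx -mulmxBr dotv_orthogonal //.
  exact: We.
under eq_bigr do rewrite col_mulmx.
by rewrite -mulmx_sumr Ws mulmx0.
Qed.

Lemma centered_simplex_perm (s : 'S_n.+1) W :
  centered_simplex d2 W -> centered_simplex d2 (col_perm s W).
Proof.
have cE i : col i (col_perm s W) = col (s i) W.
  by apply/colP => x; rewrite !mxE.
move=> [We Ws]; split.
  move=> i j iA jA ij; rewrite !cE; apply: We; rewrite ?inE //.
  by rewrite (inj_eq (@perm_inj _ s)).
under eq_bigr do rewrite cE.
by rewrite -[RHS]Ws [RHS](reindex_inj (@perm_inj _ s)).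
Qed.

(** Both sides are the determinant of one block matrix, factored as lower times
    upper and as upper times lower triangular. *)
Lemma det_rank1 (u v : 'cV[R]_n) : \det (1%:M - u *m v^T) = 1 - dotv v u.
Proof.
pose B := block_mx (1%:M : 'M[R]_1) v^T u (1%:M : 'M[R]_n).
have <- : \det B = \det (1%:M - u *m v^T).
  have -> : B = block_mx 1%:M 0 u 1%:M *m block_mx 1%:M v^T 0 (1%:M - u *m v^T).
    by rewrite mulmx_block !(mul1mx, mulmx1, mul0mx, mulmx0, addr0, add0r) addrC subrK.
  by rewrite det_mulmx det_lblock det_ublock !det1 !mul1r.
have -> : B = block_mx 1%:M v^T 0 1%:M *m block_mx (1%:M - v^T *m u) 0 u 1%:M.
  by rewrite mulmx_block !(mul1mx, mulmx1, mul0mx, mulmx0, addr0, add0r) subrK.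
rewrite det_mulmx det_lblock det_ublock !det1 !mul1r mulr1 det_mx11 !mxE eqxx dotvE.
by congr (_ - _); apply: eq_bigr => i _; rewrite mxE.
Qed.

(** Swapping two vertices of a regular simplex is induced by the reflection in
    their bisecting hyperplane. *)
Lemma det_transport_tperm E i j : centered_simplex d2 E -> i != j ->
  \det (transport E (col_perm (tperm i j) E)) = -1.
Proof.
move=> Es ij; pose v := col i E - col j E.
have pE : col_perm (tperm i j) E = E - v *m (delta_mx i 0 - delta_mx j 0)^T.
  apply/matrixP => x l; rewrite !mxE big_ord1 /v !mxE !andbT.
  case: tpermP => [->|->|/eqP il /eqP jl].
  - by rewrite eqxx (negPf ij) mulr1n mulr0n; ring.
  - by rewrite eqxx eq_sym (negPf ij) mulr1n mulr0n; ring.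
  - by rewrite (negPf il) (negPf jl) mulr0n; ring.
have -> : transport E (col_perm (tperm i j) E) =
    1%:M - (v *m ((d2 / 2)^-1 *: v)^T).
  rewrite /transport pE mulmxBl (centered_simplex_frame d2_neq0 Es).
  rewrite scalerBr scale_scalar_mx mulVf // -mulmxA -trmx_mul mulmxBr -!colE -/v.
  have -> : ((d2 / 2)^-1 *: v)^T = (d2 / 2)^-1 *: v^T by rewrite linearZ.
  by rewrite -scalemxAr.
rewrite det_rank1 dotvZl /v (Es.1 i j) ?inE //.
by rewrite invf_div; field.
Qed.

(** If the orthogonal map from E to W reverses the orientation, compose it with the
    reflection that swaps two vertices other than k; they exist since n >= 2. *)
Lemma centered_simplex_SO E W k : (2 <= n)%N ->
  centered_simplex d2 E -> centered_simplex d2 W ->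
  exists g (s : 'S_n.+1), [/\ SO R n g, s k = k & W = col_perm s (g *m E)].
Proof.
move=> n2 Es Ws; pose g := transport E W.
have gg : g^T *m g = 1%:M := transport_orthogonal Es Ws.
have gE : g *m E = W := transport_mul Es Ws.
have : \det g ^+ 2 = 1 by rewrite expr2 -{1}det_tr -det_mulmx gg det1.
move/eqP; rewrite sqrf_eq1 => /orP[]/eqP dg.
  by exists g, 1%g; rewrite perm1 col_perm1 gE.
pose i := lift k (Ordinal (ltnW n2)); pose j := lift k (Ordinal n2).
have ij : i != j by apply/eqP => /lift_inj/(congr1 val).
pose s := tperm i j; pose r := transport E (col_perm s E).
have sE : centered_simplex d2 (col_perm s E) by exact: centered_simplex_perm.
have rE : r *m E = col_perm s E := transport_mul Es sE.
have rr : r^T *m r = 1%:M := transport_orthogonal Es sE.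
exists (g *m r), s; split.
- split; first by rewrite trmx_mul mulmxA -(mulmxA _ _ g) gg mulmx1.
  by rewrite det_mulmx dg det_transport_tperm // mulrNN mulr1.
- by rewrite tpermD // eq_sym neq_lift.
- rewrite -mulmxA rE !col_permE -!mulmxA -perm_mxM -invMg tperm2 invg1 perm_mx1.
  by rewrite mulmx1 gE.
Qed.

End Transport.

(** * Faces, hulls and their symmetries *)

Section Hulls.
Variables (R : realType) (n N : nat).
Implicit Types (V : 'M[R]_(n, N)) (A : {set 'I_N}) (h : 'M[R]_n).

Lemma face_delta A i : i \in A -> face R N A (delta_mx i 0).
Proof.
move=> iA; split.
- by move=> j; rewrite mxE ler0n.
- exact: sum_delta_mx.
- by move=> j jA; rewrite mxE; case: eqVneq jA => [->|//]; rewrite iA.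
Qed.

(** The sum of t_i (1 - t_i) is zero and all its terms are nonnegative. *)
Lemma unit_weights_delta (t : 'cV[R]_N) : (forall i, 0 <= t i 0) ->
  \sum_i t i 0 = 1 -> dotv t t = 1 -> exists i, t = delta_mx i 0.
Proof.
move=> t0 t1 tt.
have tle1 i : t i 0 <= 1.
  by rewrite -t1 (bigD1 i) //= lerDl; apply: sumr_ge0.
have t01 i : t i 0 * (1 - t i 0) = 0.
  have S0 : \sum_i t i 0 * (1 - t i 0) = 0.
    under eq_bigr do rewrite mulrBr mulr1.
    by rewrite sumrB t1 -dotvE tt subrr.
  by apply: (psumr_eq0P _ S0) => // j _; rewrite mulr_ge0 // subr_ge0.
have [i ti] : exists i, t i 0 != 0.
  apply/existsP; apply/contraT; rewrite negb_exists => /forallP tz.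
  have : \sum_i t i 0 = 0 by apply: big1 => i _; apply/eqP; have := tz i; rewrite negbK.
  by rewrite t1 => /eqP; rewrite oner_eq0.
have {ti} ti : t i 0 = 1.
  by have /eqP := t01 i; rewrite mulf_eq0 (negPf ti) /= subr_eq0 => /eqP.
exists i; apply/colP => j; rewrite mxE andbT; case: eqVneq => [->//|ji].
have : \sum_(l | l != i) t l 0 = 0.
  have /eqP := t1; rewrite (bigD1 i) //= ti eq_sym -subr_eq0 opprD addrA.
  by rewrite subrr sub0r oppr_eq0 => /eqP.
by move/psumr_eq0P => -> //.
Qed.

Lemma mul_row_perm h V A (s : 'S_N) (c : 'cV[R]_N) :
  {in A, forall i, h *m col i V = col (s i) V} ->
  (forall i, i \notin A -> c i 0 = 0) ->
  h *m (V *m c) = V *m row_perm s^-1 c.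
Proof.
move=> hV cA; rewrite !(mulmx_cols V) mulmx_sumr [RHS](reindex_inj (@perm_inj _ s)).
apply: eq_bigr => i _; rewrite mxE permK -scalemxAr.
by have [iA|/cA->] := boolP (i \in A); [rewrite hV|rewrite !scale0r].
Qed.

Lemma face_row_perm A (s : 'S_N) t : (forall i, (s i \in A) = (i \in A)) ->
  face R N A t -> face R N A (row_perm s t).
Proof.
move=> sA [t0 t1 tA]; split.
- by move=> i; rewrite mxE.
- by rewrite -t1 [RHS](reindex_inj (@perm_inj _ s)); apply: eq_bigr => i _; rewrite mxE.
- by move=> i iA; rewrite mxE tA // sA.
Qed.

Lemma perm_stableV A (s : 'S_N) : (forall i, (s i \in A) = (i \in A)) ->
  forall i, (s^-1%g i \in A) = (i \in A).
Proof. by move=> sA i; rewrite -sA permKV. Qed.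

Lemma preserves_hull h V A (s : 'S_N) :
  {in A, forall i, h *m col i V = col (s i) V} ->
  (forall i, (s i \in A) = (i \in A)) -> preserves h (hull V A).
Proof.
move=> hV sA; apply/seteqP; split=> [_ [_ [t tA <-] <-]|_ [t tA <-]].
  exists (row_perm s^-1 t); first exact: face_row_perm (perm_stableV sA) tA.
  by rewrite (mul_row_perm hV) //; case: tA.
have stA := face_row_perm sA tA.
exists (V *m row_perm s t); first by exists (row_perm s t).
rewrite (mul_row_perm hV); last by case: stA.
by rewrite -row_permM mulVg row_perm1.
Qed.

(** The norm is strictly convex along the face, so the vertices are exactly
    the points of the hull that are farthest from the origin; an orthogonal
    map preserving the hull has to permute them. *)
Lemma hull_vertices h V A (alpha beta : R) : 0 < alpha ->
  (forall t, face R N A t -> dotv (V *m t) (V *m t) = alpha * dotv t t + beta) ->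
  {in A &, injective (fun i => col i V)} ->
  h^T *m h = 1%:M -> preserves h (hull V A) ->
  exists s : 'S_N, (forall i, (s i \in A) = (i \in A)) /\
    (forall i, i \notin A -> s i = i) /\
    {in A, forall i, h *m col i V = col (s i) V}.
Proof.
move=> a0 Vnorm Vinj hh hV.
have img i : i \in A -> exists j, j \in A /\ h *m col i V = col j V.
  move=> iA; have fi := face_delta iA.
  have : hull V A (h *m col i V).
    by rewrite -hV; exists (col i V) => //; exists (delta_mx i 0); rewrite // -colE.
  move=> [t ft Vt].
  have : dotv (V *m t) (V *m t) = dotv (col i V) (col i V).
    by rewrite Vt dotv_orthogonal.
  rewrite colE (Vnorm t ft) (Vnorm _ fi) => /addIr /(mulfI (lt0r_neq0 a0)).
  rewrite dot_delta mxE !eqxx => tt; case: ft => t0 t1 tA.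
  have [j tj] := unit_weights_delta t0 t1 tt.
  exists j; split; last by rewrite -colE -Vt tj -colE.
  by apply: contraT => /tA; rewrite tj mxE !eqxx => /eqP; rewrite oner_eq0.
pose f i := if i \in A then odflt i [pick j in A | h *m col i V == col j V] else i.
have fP i : i \in A -> f i \in A /\ h *m col i V = col (f i) V.
  move=> iA; rewrite /f iA; have [j [jA e]] := img i iA.
  by case: pickP => [l /andP[lA /eqP] //|/(_ j)]; rewrite jA e eqxx.
have fA i : (f i \in A) = (i \in A).
  have [iA|iA] := boolP (i \in A); first by case: (fP i iA).
  by rewrite /f (negPf iA); exact/negbTE.
have fN i : i \notin A -> f i = i by move=> iA; rewrite /f (negPf iA).
have f_inj : injective f.
  move=> i j fij; have [iA|iA] := boolP (i \in A).
    have jA : j \in A by rewrite -fA -fij fA.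
    apply: (Vinj _ _ iA jA); rewrite -[LHS]mul1mx -[RHS]mul1mx -hh -!mulmxA.
    by rewrite (fP i iA).2 (fP j jA).2 fij.
  have jA : j \notin A by rewrite -fA -fij fA.
  by rewrite -(fN i iA) fij fN.
exists (perm f_inj); split; first by move=> i; rewrite permE.
split=> [i iA|i iA]; rewrite permE; first exact: fN.
exact: (fP i iA).2.
Qed.

End Hulls.

(** * Symmetries of a regular simplex and of a facet *)

Section Stabilizers.
Variables (R : realType) (n : nat) (d2 : R) (D : 'M[R]_(n, n.+1)) (k : 'I_n.+1).
Hypothesis n_ge2 : (2 <= n)%N.
Hypothesis d2_gt0 : 0 < d2.
Hypothesis D_simplex : centered_simplex d2 D.
Implicit Types h : 'M[R]_n.

Let d2_neq0 : d2 != 0. Proof. exact: lt0r_neq0. Qed.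
Let half_gt0 : 0 < d2 / 2. Proof. by rewrite divr_gt0. Qed.
Let n_neq0 : n%:R != 0 :> R. Proof. by rewrite pnatr_eq0 -lt0n ltnW. Qed.
Let nS_neq0 : n%:R + 1 != 0 :> R. Proof. by rewrite natr1 pnatr_eq0. Qed.
Let F := (~: [set k])%SET.

Let inF i : (i \in F) = (i != k). Proof. by rewrite !inE. Qed.

Let F_perm (s : 'S_n.+1) : s k = k -> forall i, (s i \in F) = (i \in F).
Proof. by move=> sk i; rewrite !inF -{1}sk (inj_eq (@perm_inj _ s)). Qed.

Let D_norm A (t : 'cV[R]_n.+1) : face R n.+1 A t ->
  dotv (D *m t) (D *m t) = d2 / 2 * dotv t t + - (d2 / 2 / n.+1%:R).
Proof. by case=> _ t1 _; rewrite (centered_simplex_dot D_simplex) t1; ring. Qed.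

Let D_inj (A : {set 'I_n.+1}) : {in A &, injective (fun i => col i D)}.
Proof. by move=> i j _ _; exact: centered_simplex_inj d2_neq0 D_simplex _ _. Qed.

Let sum_facet : \sum_(i | i != k) col i D = - col k D.
Proof.
have /eqP := D_simplex.2; rewrite (bigD1 k) //= addrC addr_eq0.
by move=> /eqP.
Qed.

Lemma alt_simplexP h : alt_simplex D h <->
  SO R n h /\ exists s : 'S_n.+1, forall i, h *m col i D = col (s i) D.
Proof.
split=> [[Sh hD]|[Sh [s hD]]]; split=> //.
  have [s [_ [_ hs]]] := hull_vertices half_gt0 (@D_norm _)
    (@D_inj _) Sh.1 hD.
  by exists s => i; apply: hs; rewrite inE.
by apply: (preserves_hull (s := s)) => i; rewrite ?inE // hD.
Qed.

(** Preserving the facet implies preserving the simplex: the vertex k is the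
    opposite of the sum of the vertices of the facet. *)
Lemma alt_facetP h : alt_facet D k h <->
  SO R n h /\ exists2 s : 'S_n.+1, s k = k & forall i, h *m col i D = col (s i) D.
Proof.
split=> [[[Sh _] hF]|[Sh [s sk hD]]].
  split=> //.
  have [s [sF [sN hs]]] := hull_vertices half_gt0 (@D_norm _)
    (@D_inj _) Sh.1 hF.
  have sk : s k = k by apply: sN; rewrite inF eqxx.
  exists s => // i; have [->|ik] := eqVneq i k; last by apply: hs; rewrite inF.
  apply: oppr_inj; rewrite sk -mulmxN -sum_facet mulmx_sumr.
  rewrite [RHS](reindex_inj (@perm_inj _ s)) /=.
  apply: eq_big => [j|j jk]; last by apply: hs; rewrite inF.
  by rewrite -!inF sF.
split; first by apply/alt_simplexP; split=> //; exists s.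
by apply: (preserves_hull (s := s)) => [i _|]; [exact: hD|exact: F_perm].
Qed.

(** The facet opposite to k moved to have its barycenter at the origin, written on
    the labels of D; its column k is a filler and not a vertex. *)
Definition facet_at_origin : 'M[R]_(n, n.+1) :=
  \matrix_(x, j) (D x j + D x k / n%:R).

Lemma col_facet_at_origin j :
  col j facet_at_origin = col j D + n%:R^-1 *: col k D.
Proof. by apply/colP => x; rewrite !mxE mulrC. Qed.

Let B := facet_at_origin.

Lemma mul_facet_at_origin (c : 'cV[R]_n.+1) :
  B *m c = D *m c + ((\sum_i c i 0) / n%:R) *: col k D.
Proof.
rewrite !mulmx_cols; under eq_bigr do rewrite col_facet_at_origin scalerDr.
rewrite big_split /=; congr (_ + _); rewrite mulr_suml scaler_suml.
by apply: eq_bigr => i _; rewrite scalerA.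
Qed.

Lemma barycenter_facet : barycenter D F = - (n%:R^-1 *: col k D).
Proof.
rewrite /barycenter (eq_bigl (fun i => i != k)) => [|i]; last exact: inF.
by rewrite sum_facet scalerN cardsC1 card_ord.
Qed.

Lemma centered_facetE : centered_facet D k = hull B F.
Proof.
have E t : face R n.+1 F t -> D *m t - barycenter D F = B *m t.
  case=> _ t1 _; rewrite mul_facet_at_origin t1 barycenter_facet opprK.
  by rewrite mul1r.
apply/seteqP; split=> [_ [_ [t ft <-] <-]|_ [t ft <-]].
  by exists t => //; rewrite E.
by exists (D *m t); [exists t|rewrite E].
Qed.

Let B_norm (t : 'cV[R]_n.+1) : face R n.+1 F t ->
  dotv (B *m t) (B *m t) = d2 / 2 * dotv t t + - (d2 / 2 / n%:R).
Proof.
case=> _ t1 tF; rewrite mul_facet_at_origin t1 mul1r.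
have tk : t k 0 = 0 by apply: tF; rewrite inF eqxx.
have -> : D *m t + n%:R^-1 *: col k D = D *m (t + n%:R^-1 *: delta_mx k 0).
  by rewrite mulmxDr -scalemxAr -colE.
rewrite (centered_simplex_dot D_simplex) !dotv_linear (dotvC t) !dot_delta tk.
have -> : \sum_i (t + n%:R^-1 *: delta_mx k 0) i 0 = 1 + n%:R^-1.
  under eq_bigr do rewrite !mxE andbT.
  rewrite big_split /= t1 -mulr_sumr (bigD1 k) //= big1 => [|i /negPf->//].
  by rewrite eqxx addr0 mulr1.
by rewrite mxE !eqxx -[n.+1%:R]natr1 ?mulr1n; field; rewrite n_neq0 nS_neq0.
Qed.

Lemma facet_at_origin_perp i : i != k -> dotv (col k D) (col i B) = 0.
Proof.
move=> ik; rewrite col_facet_at_origin !dotv_linear !(centered_simplex_gram D_simplex).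
by rewrite eqxx eq_sym (negPf ik) mulr1n mulr0n -[n.+1%:R]natr1; field; rewrite n_neq0 nS_neq0.
Qed.

Let B_inj : {in F &, injective (fun i => col i B)}.
Proof.
move=> i j _ _; rewrite !col_facet_at_origin => /addIr.
exact: centered_simplex_inj d2_neq0 D_simplex _ _.
Qed.

(** Moving its barycenter to the origin makes the facet orthogonal to the
    opposite vertex, which an orthogonal symmetry of the facet can then only
    fix or negate. *)
Lemma facet_symmetry_apex h (s : 'S_n.+1) : h^T *m h = 1%:M -> s k = k ->
  (forall i, i != k -> h *m col i B = col (s i) B) ->
  exists2 e : R, e = 1 \/ e = -1 & h *m col k D = e *: col k D.
Proof.
move=> hh sk hs.
have hkB j : j != k -> dotv (h *m col k D) (col j B) = 0.
  move=> jk; have sVj : (s^-1)%g j != k.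
    by rewrite -(inj_eq (@perm_inj _ s)) permKV sk.
  by rewrite -(permKV s j) -hs // dotv_orthogonal // facet_at_origin_perp.
have [|e he] := centered_simplex_perp d2_neq0 D_simplex (x := h *m col k D)
    (k := k) (ltnW n_ge2).
  move=> i j ik jk.
  have -> : col i D - col j D = col i B - col j B.
    by rewrite !col_facet_at_origin opprD addrACA subrr addr0.
  by rewrite dotvBr !hkB ?subrr.
exists e => //.
have : dotv (h *m col k D) (h *m col k D) = dotv (col k D) (col k D).
  by rewrite dotv_orthogonal.
have dk : dotv (col k D) (col k D) != 0.
  rewrite (centered_simplex_gram D_simplex) eqxx !mulf_neq0 ?invr_eq0 ?pnatr_eq0 //.
  rewrite -[n.+1%:R]natr1 mulr1n; apply/eqP => e0.
  have : (n%:R + 1) * (1 - (n%:R + 1)^-1) = n%:R :> R by field.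
  by rewrite e0 mulr0 => /esym/eqP; rewrite (negPf n_neq0).
rewrite he !dotv_linear mulrA => /eqP; rewrite -subr_eq0 -[X in _ - X]mul1r.
rewrite -mulrBl mulf_eq0 (negPf dk) orbF subr_eq0 -expr2 sqrf_eq1.
by move=> /orP[]/eqP; [left|right].
Qed.

(** The direction of the facet consists of the combinations of weight zero of the
    vertices of the centered facet, so a symmetry of the latter preserves it. *)
Lemma sym_facetP h : sym_facet D k h <->
  SO R n h /\ exists2 s : 'S_n.+1, s k = k &
    forall i, i != k -> h *m col i B = col (s i) B.
Proof.
split=> [[Sh _ hF]|[Sh [s sk hB]]].
  split=> //; move: hF; rewrite centered_facetE => hF.
  have [s [sF [sN hs]]] := hull_vertices half_gt0 B_norm B_inj Sh.1 hF.
  exists s => [|i ik]; first by apply: sN; rewrite inF eqxx.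
  by apply: hs; rewrite inF.
split=> //; last first.
  rewrite centered_facetE; apply: (preserves_hull (s := s)); last exact: F_perm.
  by move=> i; rewrite inF; exact: hB.
(* The shift from D to B cancels on weights that sum to zero. *)
have DB (c : 'cV[R]_n.+1) : \sum_i c i 0 = 0 -> D *m c = B *m c.
  by move=> c0; rewrite mul_facet_at_origin c0 mul0r scale0r addr0.
have hBF : {in F, forall i, h *m col i B = col (s i) B}.
  by move=> i; rewrite inF; exact: hB.
have sumP (s' : 'S_n.+1) (c : 'cV[R]_n.+1) :
    \sum_i row_perm s' c i 0 = \sum_i c i 0.
  rewrite [RHS](reindex_inj (@perm_inj _ s')).
  by apply: eq_bigr => i _; rewrite mxE.
have cF (c : 'cV[R]_n.+1) : c k 0 = 0 -> forall i, i \notin F -> c i 0 = 0.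
  by move=> ck i; rewrite inF negbK => /eqP ->.
have sVk : (s^-1)%g k = k by apply: (@perm_inj _ s); rewrite permKV.
apply/seteqP; split=> [_ [_ [c [ck c0] <-] <-]|_ [c [ck c0] <-]].
  exists (row_perm s^-1 c); first by rewrite /= mxE sVk sumP.
  by rewrite !DB ?sumP // (mul_row_perm hBF) //; exact: cF.
exists (D *m row_perm s c).
  by exists (row_perm s c) => //=; rewrite mxE sk sumP.
rewrite !DB ?sumP // (mul_row_perm hBF); last by apply: cF; rewrite mxE sk.
by rewrite -row_permM mulVg row_perm1.
Qed.

End Stabilizers.

(** * Barycenters, heights and embeddings *)

Lemma barycenterT_eq0 (R : realType) (n m : nat) (V : 'M[R]_(n, m.+1)) :
  barycenter V [set: 'I_m.+1]%SET = 0 <-> \sum_i col i V = 0.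
Proof.
rewrite /barycenter (eq_bigl xpredT) => [|i]; last by rewrite inE.
split=> [/eqP|->]; last by rewrite scaler0.
by rewrite scaler_eq0 cardsT card_ord invr_eq0 pnatr_eq0 => /eqP.
Qed.

Lemma barycenterC1 (R : realType) (n m : nat) (V : 'M[R]_(n, m.+1)) a :
  \sum_i col i V = 0 -> barycenter V (~: [set a])%SET = - (m%:R^-1 *: col a V).
Proof.
rewrite (bigD1 a) //= addrC => /eqP; rewrite addr_eq0 => /eqP s0.
rewrite /barycenter (eq_bigl (fun i => i != a)) => [|i]; last by rewrite !inE.
by rewrite s0 scalerN cardsC1 card_ord.
Qed.

Lemma barycenterC2 (R : realType) (n m : nat) (V : 'M[R]_(n, m.+2)) a w :
  a != w -> \sum_i col i V = 0 ->
  barycenter V (~: [set a; w])%SET = - (m%:R^-1 *: (col a V + col w V)).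
Proof.
move=> aw; rewrite (bigD1 a) //= (bigD1 w) 1?eq_sym //= addrA addrC => /eqP.
rewrite addr_eq0 => /eqP s0.
rewrite /barycenter (eq_bigl (fun i => (i != a) && (i != w))) => [|i]; last first.
  by rewrite !inE negb_or.
rewrite s0 scalerN; congr (- (_^-1 *: _)); congr (_%:R).
by have := cardsC [set a; w]%SET; rewrite cards2 aw card_ord => /eqP; rewrite eqSS eqSS => /eqP.
Qed.

Section Barycenters.
Variables (R : realType) (n N : nat) (d2 : R) (V : 'M[R]_(n, N)).
Implicit Types A : {set 'I_N}.

Definition indicator A : 'cV[R]_N := \col_i (i \in A)%:R.

Lemma barycenter_mulmx A : barycenter V A = V *m (#|A|%:R^-1 *: indicator A).
Proof.
rewrite -scalemxAr mulmx_cols /barycenter big_mkcond; congr (_ *: _).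
by apply: eq_bigr => i _; rewrite mxE; case: ifP; rewrite ?scale1r ?scale0r.
Qed.

Lemma sum_indicator A : \sum_i indicator A i 0 = #|A|%:R.
Proof.
rewrite -sum1_card natr_sum [RHS]big_mkcond; apply: eq_bigr => i _.
by rewrite mxE; case: ifP.
Qed.

(** The difference is V c for weights c of sum zero supported by A and i, whether
    or not i belongs to A, so [equidistant_dot] computes its norm. *)
Lemma dist_vertex_barycenter A i : (0 < #|A|)%N ->
  equidistant d2 V (i |: A)%SET ->
  dotv (col i V - barycenter V A) (col i V - barycenter V A) =
    d2 / 2 * (1 - 2 * (i \in A)%:R / #|A|%:R + #|A|%:R^-1).
Proof.
move=> A0 Vi; have A0' : #|A|%:R != 0 :> R by rewrite pnatr_eq0 -lt0n.
pose c : 'cV[R]_N := delta_mx i 0 - #|A|%:R^-1 *: indicator A.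
have -> : col i V - barycenter V A = V *m c by rewrite mulmxBr -colE barycenter_mulmx.
have c0 : \sum_j c j 0 = 0.
  under eq_bigr do rewrite mxE [X in _ + X]mxE [X in - X]mxE.
  by rewrite sumrB sum_delta_mx -mulr_sumr sum_indicator mulVf ?subrr.
have cA j : j \notin (i |: A)%SET -> c j 0 = 0.
  by rewrite !inE negb_or !mxE => /andP[/negPf -> /negPf ->]; rewrite mulr0 subr0.
rewrite (equidistant_dot Vi cA cA c0 c0); congr (_ * _).
have dd : dotv (indicator A) (indicator A) = #|A|%:R.
  rewrite -sum_indicator dotvE; apply: eq_bigr => j _.
  by rewrite mxE; case: (_ \in _); rewrite ?mul1r ?mul0r.
rewrite /c !dotv_linear (dotvC (indicator A)) !dot_delta dd !mxE !eqxx mulr1n.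
by field.
Qed.

End Barycenters.

Section Heights.
Variables (R : realType) (n : nat).
Hypothesis n_gt0 : (0 < n)%N.

Let n_neq0 : n%:R != 0 :> R. Proof. by rewrite pnatr_eq0 -lt0n. Qed.

Lemma unit_simplex_height_sqr (h : R) : unit_simplex_height n h ->
  0 <= h /\ h ^+ 2 = (n%:R + 1) / (2 * n%:R).
Proof.
move=> [T [k [/regular_simplex1P Ts ->]]]; split; first exact: edist_ge0.
rewrite edist_sqr (@dist_vertex_barycenter _ _ _ 1) ?cardsC1 ?card_ord //.
  by rewrite !inE eqxx mulr0 mul0r; field.
by move=> i j _ _; apply: Ts; rewrite inE.
Qed.

Lemma unit_simplex_height_centered (W : 'M[R]_(n, n.+1)) k :
  centered_simplex 1 W ->
  unit_simplex_height n (edist (col k W) (- (n%:R^-1 *: col k W))).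
Proof.
move=> [We W0]; exists W, k; split; first exact/regular_simplex1P.
by rewrite barycenterC1.
Qed.

End Heights.

(** Two points of the skeleton with the same image differ by a dependence of total
    weight zero.  If that had the same nonzero weight on all of B, one of the two
    points would have positive weights on all of B, which is too large to be
    contained in a simplex of the skeleton. *)
Lemma linear_embedding_of_dependences (R : realType) (n N d : nat)
    (V : 'M[R]_(n, N)) (B : {set 'I_N}) : (d.+1 < #|B|)%N ->
  (forall c : 'cV[R]_N, V *m c = 0 -> \sum_i c i 0 = 0 ->
     c = 0 \/ exists2 a, a != 0 & {in B, forall i, c i 0 = a}) ->
  linear_embeddings R n N d V.
Proof.
move=> dB dep.
have ineq (x y : 'cV[R]_N) a : skeleton R N d x -> skeleton R N d y -> 0 < a ->
    {in B, forall i, x i 0 - y i 0 = a} -> False.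
  move=> [A Ad [_ _ xA]] [C _ [y0 _ _]] a0 xy.
  have : (#|B| <= #|A|)%N.
    apply/subset_leq_card/fintype.subsetP => i iB; apply: contraT => /xA xi.
    have := xy i iB; rewrite xi sub0r => e; move: a0; rewrite -e oppr_gt0.
    by rewrite ltNge y0.
  by rewrite leqNgt (leq_ltn_trans Ad dB).
move=> x y; rewrite !inE => sx sy Vxy; apply/eqP; rewrite -subr_eq0; apply/eqP.
have c0 : \sum_i (x - y) i 0 = 0.
  under eq_bigr do rewrite !mxE.
  by case: sx sy => [? _ [_ sx _]] [? _ [_ sy _]]; rewrite sumrB sx sy subrr.
have [|//|[a a0 xy]] := dep (x - y) _ c0; first by rewrite mulmxBr Vxy subrr.
have {}xy i : i \in B -> x i 0 - y i 0 = a by move=> /xy; rewrite !mxE.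
case: (ltgtP a 0) => [an|ap|]; last by move/eqP; rewrite (negPf a0).
  exfalso; apply: (ineq y x (- a)) => //; rewrite ?oppr_gt0 // => i /xy <-.
  by rewrite opprB.
by exfalso; exact: (ineq x y a).
Qed.

(** * The model simplex with unit edges *)

Section FramedStabilizers.
Variables (R : realType) (n : nat) (ell : R) (D : 'M[R]_(n, n.+1)) (k : 'I_n.+1).
Hypothesis n_ge2 : (2 <= n)%N.
Hypothesis D_regular : regular_simplex ell D [set: 'I_n.+1]%SET.
Hypothesis D_centered : barycenter D [set: 'I_n.+1]%SET = 0.

(** For edges of length zero all the vertices would coincide, against affine
    independence. *)
Lemma edge_gt0 : 0 < ell.
Proof.
have [Da De] := D_regular.
pose i : 'I_n.+1 := Ordinal (ltn0Sn n).
pose j : 'I_n.+1 := Ordinal (ltnW n_ge2 : (1 < n.+1)%N).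
have ij : i != j by [].
have e := De i j (finset.in_setT i) (finset.in_setT j) ij.
rewrite lt_def -{2}e edist_ge0 andbT; apply/eqP => ell0.
have := e; rewrite ell0 => /(edist_eq _ _ (lexx 0)); rewrite expr0n => /dotv_eq0 /eqP.
rewrite subr_eq0 => /eqP Dij.
have c0 : \sum_m (delta_mx i 0 - delta_mx j 0 : 'cV[R]_n.+1) m 0 = 0.
  by under eq_bigr do rewrite mxE [X in _ + X]mxE; rewrite sumrB !sum_delta_mx subrr.
have /colP/(_ i) : delta_mx i 0 - delta_mx j 0 = 0 :> 'cV[R]_n.+1.
  by apply: Da => [m||]; rewrite ?inE // mulmxBr -!colE Dij subrr.
by rewrite !mxE !eqxx (negPf ij) subr0 => /eqP; rewrite oner_eq0.
Qed.

Lemma edge_neq0 : ell != 0. Proof. by rewrite gt_eqF ?edge_gt0. Qed.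

Lemma D_simplex : centered_simplex (ell ^+ 2) D.
Proof.
split; last exact/barycenterT_eq0.
move=> i j iA jA ij; apply/(edist_eq _ _ (ltW edge_gt0)).
by have [_] := D_regular; exact.
Qed.

Definition unit_frame : 'M[R]_(n, n.+1) := ell^-1 *: D.
Local Notation E := unit_frame.

Lemma col_unit_frame i : col i E = ell^-1 *: col i D.
Proof. by apply/colP => x; rewrite !mxE. Qed.

Lemma unit_frame_simplex : centered_simplex 1 E.
Proof.
have [De D0] := D_simplex; split; last first.
  by under eq_bigr do rewrite col_unit_frame; rewrite -scaler_sumr D0 scaler0.
move=> i j iA jA ij; rewrite !col_unit_frame -scalerBr dotvZl dotvZr De //.
by field; exact: edge_neq0.
Qed.

Lemma unit_frameZ (h : 'M[R]_n) i j (e : R) :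
  (h *m col i D = e *: col j D) <-> (h *m col i E = e *: col j E).
Proof.
rewrite !col_unit_frame -scalemxAr scalerA (mulrC e) -scalerA.
by split=> [->//|/scalerI]; apply; rewrite invr_eq0 edge_neq0.
Qed.

Lemma unit_frame_scale (h : 'M[R]_n) i j :
  (h *m col i D = col j D) <-> (h *m col i E = col j E).
Proof. by have := unit_frameZ h i j 1; rewrite !scale1r. Qed.

Let ell2_gt0 : 0 < ell ^+ 2. Proof. by rewrite exprn_gt0 ?edge_gt0. Qed.

Lemma alt_simplex_frame h : alt_simplex D h <->
  SO R n h /\ exists s : 'S_n.+1, forall i, h *m col i E = col (s i) E.
Proof.
rewrite (alt_simplexP ell2_gt0 D_simplex).
by split=> -[Sh [s hs]]; split=> //; exists s => i; apply/unit_frame_scale.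
Qed.

Lemma alt_facet_frame h : alt_facet D k h <->
  SO R n h /\ exists2 s : 'S_n.+1, s k = k & forall i, h *m col i E = col (s i) E.
Proof.
rewrite (alt_facetP k ell2_gt0 D_simplex).
by split=> -[Sh [s sk hs]]; split=> //; exists s => // i; apply/unit_frame_scale.
Qed.

Let frame_bS h i j :
  (h *m (col i E + n%:R^-1 *: col k E) = col j E + n%:R^-1 *: col k E) <->
  (h *m col i (facet_at_origin D k) = col j (facet_at_origin D k)).
Proof.
have bE l : col l E + n%:R^-1 *: col k E = ell^-1 *: col l (facet_at_origin D k).
  by rewrite col_facet_at_origin !col_unit_frame scalerDr !scalerA mulrC.
rewrite !bE -scalemxAr; split=> [/scalerI|->//].
by apply; rewrite invr_eq0 edge_neq0.
Qed.

Lemma sym_facet_frame h : sym_facet D k h <->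
  SO R n h /\ exists2 s : 'S_n.+1, s k = k &
    forall i, i != k -> h *m (col i E + n%:R^-1 *: col k E) =
                        col (s i) E + n%:R^-1 *: col k E.
Proof.
rewrite (sym_facetP k n_ge2 ell2_gt0 D_simplex).
by split=> -[Sh [s sk hs]]; split=> //; exists s => // i ik; apply/frame_bS; exact: hs.
Qed.

Local Notation stab :=
  (end_stabilizer (alt_facet D k) (alt_simplex D) (sym_facet D k)).

(** The rotation g'^-1 g permutes the vertices of E; this is how a coincidence of
    two configurations yields an element of the group. *)
Lemma same_frame (g g' : 'M[R]_n) (s : 'S_n.+1) (t : R) :
  SO R n g -> SO R n g' -> t != 1 -> (t != 0 -> s k = k) ->
  (forall i, col i (g *m E) = col (s i) (g' *m E)) ->
  exists2 h, stab t h & g = g' *m h.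
Proof.
move=> Sg Sg' t1 sk gs; exists (g'^T *m g); last by rewrite mulmxA SO_mul_tr ?mul1mx.
have Sh : SO R n (g'^T *m g) by apply: SOM => //; exact: SOV.
have hs i : g'^T *m g *m col i E = col (s i) E.
  by rewrite -mulmxA -col_mulmx gs col_mulmx mulmxA SO_tr_mul ?mul1mx.
rewrite /end_stabilizer (negPf t1); case: eqVneq => [_|/sk sk'].
  by apply/alt_simplex_frame; split=> //; exists s.
by apply/alt_facet_frame; split=> //; exists s.
Qed.

(** The analogue at t = 1, where only the facet of each frame is known. *)
Lemma same_facet_frame (g g' : 'M[R]_n) (s : 'S_n.+1) :
  SO R n g -> SO R n g' -> s k = k ->
  (forall i, i != k -> col i (g *m E) + n%:R^-1 *: col k (g *m E) =
     col (s i) (g' *m E) + n%:R^-1 *: col k (g' *m E)) ->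
  exists2 h, stab 1 h & g = g' *m h.
Proof.
move=> Sg Sg' sk gs; exists (g'^T *m g); last by rewrite mulmxA SO_mul_tr ?mul1mx.
have Sh : SO R n (g'^T *m g) by apply: SOM => //; exact: SOV.
rewrite /end_stabilizer oner_eq0 eqxx; apply/sym_facet_frame; split=> //.
exists s => // i ik.
have cE j : col j (g *m E) + n%:R^-1 *: col k (g *m E) =
    g *m (col j E + n%:R^-1 *: col k E).
  by rewrite !col_mulmx mulmxDr -scalemxAr.
have cE' j : col j (g' *m E) + n%:R^-1 *: col k (g' *m E) =
    g' *m (col j E + n%:R^-1 *: col k E).
  by rewrite !col_mulmx mulmxDr -scalemxAr.
by rewrite -mulmxA -cE gs // cE' mulmxA SO_tr_mul ?mul1mx.
Qed.

Lemma stab_frame t h : stab t h -> t != 1 -> exists s : 'S_n.+1,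
  (t != 0 -> s k = k) /\ forall i, h *m col i E = col (s i) E.
Proof.
rewrite /end_stabilizer => + t1; rewrite (negPf t1); case: eqVneq => _.
  by move=> /alt_simplex_frame[_ [s hs]]; exists s.
by move=> /alt_facet_frame[_ [s sk hs]]; exists s.
Qed.

Lemma stab1_frame h : stab 1 h -> exists (s : 'S_n.+1) (e : R),
  [/\ s k = k, e = 1 \/ e = -1, h *m col k E = e *: col k E &
    forall i, i != k -> h *m (col i E + n%:R^-1 *: col k E) =
                        col (s i) E + n%:R^-1 *: col k E].
Proof.
rewrite /end_stabilizer oner_eq0 eqxx => /sym_facet_frame[Sh [s sk hs]].
have [|e e1 he] := facet_symmetry_apex n_ge2 ell2_gt0 D_simplex Sh.1 sk.
  by move=> i ik; apply/frame_bS; exact: hs.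
by exists s, e; split=> //; apply/unit_frameZ.
Qed.

Lemma alt_facet_SO : alt_facet D k `<=` SO R n.
Proof. by move=> h [[]]. Qed.

Lemma alt_facet_alt_simplex : alt_facet D k `<=` alt_simplex D.
Proof. by move=> h []. Qed.

Lemma alt_facet_sym_facet : alt_facet D k `<=` sym_facet D k.
Proof.
move=> h /alt_facet_frame[Sh [s sk hs]]; apply/sym_facet_frame; split=> //.
exists s => // i ik.
by rewrite mulmxDr -scalemxAr !hs sk.
Qed.

End FramedStabilizers.

(** * Pyramids over a regular simplex *)

Lemma affine_continuous (R : realType) (p q : R) : continuous (fun t : R => p + t * q).
Proof.
move=> t; apply: (@continuousD _ _ _ (fun=> p) (fun t : R => t * q)).
  exact: cst_continuous.
exact: mulrr_continuous.
Qed.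

Section ConeK.
Variables (R : realType) (n : nat) (k : 'I_n.+1).
Hypothesis n_ge2 : (2 <= n)%N.
Implicit Types (W : 'M[R]_(n, n.+1)) (t : R).

Let n_gt0 : (0 < n)%N. Proof. exact: ltnW. Qed.
Let n_neq0 : n%:R != 0 :> R. Proof. by rewrite pnatr_eq0 -lt0n. Qed.
Let nS_neq0 : n%:R + 1 != 0 :> R. Proof. by rewrite natr1 pnatr_eq0. Qed.
Let n_ge2R : 2 <= n%:R :> R. Proof. by rewrite ler_nat. Qed.

(** The facet of W opposite to a, with the vertex a pushed along its axis to the
    fraction 1 - t of its height, and the result recentered at the origin: the
    shift by t / n on the base is the recentering. *)
Definition cone a W t : 'M[R]_(n, n.+1) := of_cols (fun j =>
  if j == a then (1 - t) *: col a W else col j W + (t / n%:R) *: col a W).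

Lemma col_cone_apex a W t : col a (cone a W t) = (1 - t) *: col a W.
Proof. by rewrite col_of_cols eqxx. Qed.

Lemma col_cone a W t j : j != a ->
  col j (cone a W t) = col j W + (t / n%:R) *: col a W.
Proof. by rewrite col_of_cols => /negPf ->. Qed.

Lemma mulmx_cone (g : 'M[R]_n) a W t : g *m cone a W t = cone a (g *m W) t.
Proof.
apply: eq_cols => j; rewrite col_mulmx !col_of_cols; case: eqP => _.
  by rewrite col_mulmx -scalemxAr.
by rewrite mulmxDr -scalemxAr !col_mulmx.
Qed.

Lemma col_perm_cone (s : 'S_n.+1) a W t :
  col_perm s (cone (s a) W t) = cone a (col_perm s W) t.
Proof.
apply: eq_cols => j; rewrite col_col_perm !col_of_cols !col_col_perm.
by rewrite (inj_eq (@perm_inj _ s)).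
Qed.

Lemma cone_continuous a W : continuous (cone a W).
Proof.
apply: continuous_into_matrix => i j.
pose q := if j == a then - W i a else W i a / n%:R.
rewrite (_ : (fun t => _) = (fun t => W i j + t * q)); first exact: affine_continuous.
apply/funext => t; rewrite mxE /q; case: eqP => [->|_]; rewrite !mxE; ring.
Qed.

(** Relative to the base, whose vertices are shifted by (t / n) w_a, the apex is
    moved by - (t + t / n) w_a; a common shift has no effect on weights that sum to
    zero. *)
Lemma cone_mul a W t (c : 'cV[R]_n.+1) : \sum_i c i 0 = 0 ->
  cone a W t *m c = W *m (c - (t * (n%:R + 1) / n%:R * c a 0) *: delta_mx a 0).
Proof.
move=> c0; rewrite mulmxBr -scalemxAr -colE !mulmx_cols.
have colE' j : c j 0 *: col j (cone a W t) =
    c j 0 *: col j W + (c j 0 * (t / n%:R)) *: col a W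
    - (if j == a then (c j 0 * (t * (n%:R + 1) / n%:R)) *: col a W else 0).
  have [->|ja] := eqVneq j a; last by rewrite col_cone // subr0 scalerDr scalerA.
  by rewrite col_cone_apex scalerA -!scalerDl -scalerBl; congr (_ *: _); field.
rewrite (eq_bigr _ (fun j _ => colE' j)) sumrB big_split /= -scaler_suml -mulr_suml c0.
rewrite mul0r scale0r addr0 -big_mkcond big_pred1_eq.
by rewrite (mulrC (c a 0)).
Qed.

Section Config.
Variables (a : 'I_n.+1) (W : 'M[R]_(n, n.+1)) (t : R).
Hypothesis W_simplex : centered_simplex 1 W.
Hypothesis t01 : 0 <= t <= 1.

Let gram i j : dotv (col i W) (col j W) = 1 / 2 * ((i == j)%:R - n.+1%:R^-1).
Proof. exact: centered_simplex_gram W_simplex _ _. Qed.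

(** The only possible dependence, which occurs at t = 1, expresses the apex as the
    barycenter of the facet, with equal weights on its n vertices. *)
Lemma cone_embedding : linear_embeddings R n n.+1 (n - 2) (cone a W t).
Proof.
apply: (linear_embedding_of_dependences (B := (~: [set a])%SET)).
  rewrite cardsC1 card_ord; move: n_ge2; case: (n) => [|[|m]] // _.
  by rewrite !subSS subn0.
move=> c Vc c0; move: Vc; rewrite (cone_mul _ _ _ c0).
move=> /(centered_simplex_kernel (oner_neq0 R) W_simplex) ker.
set b := (\sum_i _) / _ in ker.
have cb i : i != a -> c i 0 = b.
  by move=> ia; have := ker i; rewrite !mxE (negPf ia) /= mulr0 subr0.
have ca : c a 0 = - (n%:R * b).
  have /eqP := c0; rewrite (bigD1 a) //= (eq_bigr (fun=> b)) //.
  by rewrite sumr_const cardC1 card_ord addr_eq0 mulr_natl => /eqP.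
have [b0|b0] := eqVneq b 0; [left|right].
  apply/colP => i; rewrite [RHS]mxE.
  by have [->|/cb->//] := eqVneq i a; rewrite ca b0 mulr0 oppr0.
by exists b => // i; rewrite !inE; exact: cb.
Qed.

Lemma cone_sum : \sum_j col j (cone a W t) = 0.
Proof.
rewrite (bigD1 a) //= col_cone_apex.
rewrite (eq_bigr (fun j => col j W + (t / n%:R) *: col a W)); last first.
  by move=> j; exact: col_cone.
rewrite big_split /= sumr_const cardC1 card_ord.
have := W_simplex.2; rewrite (bigD1 a) //= addrC => /eqP; rewrite addr_eq0 => /eqP ->.
rewrite -scaler_nat scalerA scalerBl scale1r.
have -> : n%:R * (t / n%:R) = t by field.
by rewrite addrACA subrr add0r addNr.
Qed.

Lemma cone_pyramidal : pyramidalK (cone a W t).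
Proof.
have [t0 t1] := andP t01.
exists a => /=; have bE := barycenterC1 a cone_sum.
have colB i j : i != a -> j != a ->
    col i (cone a W t) - col j (cone a W t) = col i W - col j W.
  by move=> ia ja; rewrite !col_cone // opprD addrACA subrr addr0.
have axisE : col a (cone a W t) - - (n%:R^-1 *: col a (cone a W t)) =
    (1 - t) *: (col a W - - (n%:R^-1 *: col a W)).
  by rewrite col_cone_apex !opprK scalerDr !scalerA (mulrC (1 - t)).
split; rewrite ?bE.
- apply/regular_simplex1P => i j; rewrite !inE => ia ja ij; rewrite colB //.
  by apply: W_simplex.1; rewrite ?inE.
- move=> i j; rewrite !inE => ia ja; rewrite bE axisE colB // !dotv_linear !gram.
  by rewrite (eq_sym a) (negPf ia) (eq_sym a) (negPf ja); ring.
- exists (edist (col a W) (- (n%:R^-1 *: col a W))).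
    exact: unit_simplex_height_centered.
  rewrite edist_ge0 /= ler_sqrt ?dotv_ge0 // axisE dotvZl dotvZr mulrA.
  rewrite ler_piMl ?dotv_ge0 // mulr_ile1 //; lra.
- exact/barycenterT_eq0/cone_sum.
Qed.

End Config.

End ConeK.

Section SpaceK.
Variables (R : realType) (n : nat).
Hypothesis n_ge2 : (2 <= n)%N.

Let n_gt0 : (0 < n)%N. Proof. exact: ltnW. Qed.
Let n_neq0 : n%:R != 0 :> R. Proof. by rewrite pnatr_eq0 -lt0n. Qed.
Let nS_neq0 : n%:R + 1 != 0 :> R. Proof. by rewrite natr1 pnatr_eq0. Qed.
Let n_ge2R : 2 <= n%:R :> R. Proof. by rewrite ler_nat. Qed.

Lemma exists_rescaling (x : 'cV[R]_n) (h2 : R) : x != 0 -> 0 < h2 ->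
  exists2 a, 0 < a & a ^+ 2 * dotv x x = h2.
Proof.
move=> x0 h0; have xx : 0 < dotv x x.
  by rewrite lt_def dotv_ge0 andbT; apply: contraNneq x0 => /dotv_eq0 ->.
exists (Num.sqrt (h2 / dotv x x)); first by rewrite sqrtr_gt0 divr_gt0.
by rewrite sqr_sqrtr ?divfK ?gt_eqF // ltW // divr_gt0.
Qed.

(** The n vertices of the facet, taken from their barycenter, sum to zero, so the
    square matrix of these vectors is singular. *)
Lemma facet_normal (V : 'M[R]_(n, n.+1)) a :
  exists2 v : 'cV[R]_n, v != 0 &
    forall i, i != a -> dotv v (col i V - barycenter V (~: [set a])%SET) = 0.
Proof.
set b := barycenter _ _.
pose C : 'M[R]_n := of_cols (fun j => col (lift a j) V - b).
have sC : \sum_j col j C = 0.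
  under eq_bigr do rewrite col_of_cols.
  rewrite sumrB sumr_const card_ord /b /barycenter cardsC1 card_ord.
  rewrite -scaler_nat scalerA mulfV // scale1r.
  rewrite (eq_bigl (fun i => i != a)) => [|i]; last by rewrite !inE.
  have e1 : \sum_i col i V = col a V + \sum_(i | i != a) col i V.
    by rewrite (bigD1 a).
  have e2 : \sum_i col i V = col a V + \sum_(j < n) col (lift a j) V.
    by rewrite (bigD1_ord a).
  by apply/eqP; rewrite subr_eq0; apply/eqP/(addrI (col a V)); rewrite -e1.
have : \det C^T == 0.
  apply/det0P; exists (const_mx 1).
    by apply/eqP => /rowP/(_ (Ordinal n_gt0)); rewrite !mxE => /eqP; rewrite oner_eq0.
  apply: trmx_inj; rewrite trmx_mul trmxK trmx_const linear0 mulmx_cols -[RHS]sC.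
  by apply: eq_bigr => i _; rewrite mxE scale1r.
rewrite det_tr => /det0P[v v0 vC]; exists v^T.
  by rewrite -(inj_eq trmx_inj) trmxK linear0.
move=> i; case: (unliftP a i) => [j ->|->]; last by rewrite eqxx.
move=> _; have /rowP/(_ j) := vC; rewrite !mxE => <-; rewrite dotvE.
by apply: eq_bigr => l _; rewrite !mxE.
Qed.

(** The vector v is the altitude of the regular simplex erected on the facet on the
    side of the apex.  If the apex is the barycenter of the facet, either normal
    direction will do. *)
Lemma pyramid_axis (V : 'M[R]_(n, n.+1)) a (b := barycenter V (~: [set a])%SET) h :
  perp_axis V (~: [set a])%SET (col a V) ->
  unit_simplex_height n h -> edist (col a V) b <= h ->
  exists (v : 'cV[R]_n) (tau : R),
    [/\ dotv v v = (n%:R + 1) / (2 * n%:R), 0 <= tau <= 1,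
        col a V - b = tau *: v &
        forall i, i != a -> dotv v (col i V - b) = 0].
Proof.
move=> axis /(unit_simplex_height_sqr n_gt0)[h0 hh] dh.
have h2_gt0 : 0 < (n%:R + 1) / (2 * n%:R) :> R by rewrite divr_gt0 //; have := n_ge2R; lra.
set u := col a V - b; set F := (~: [set a])%SET in axis *.
have uF i : i != a -> dotv u (col i V - b) = 0.
  move=> ia; have -> : col i V - b = n%:R^-1 *: \sum_(j in F) (col i V - col j V).
    rewrite sumrB sumr_const scalerBr cardsC1 card_ord -(scaler_nat n (col i V)).
    by rewrite scalerA mulVf // scale1r /b /barycenter cardsC1 card_ord.
  rewrite dotvZr dotv_sumr big1 ?mulr0 // => j jF.
  by apply: axis; rewrite // !inE.
have [u0|u0] := eqVneq u 0.
  have [v v0 vF] := facet_normal V a.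
  have [r r0 rv] := exists_rescaling v0 h2_gt0.
  exists (r *: v), 0; split.
  - by rewrite dotvZl dotvZr mulrA -expr2.
  - by rewrite lexx ler01.
  - by rewrite scale0r.
  - by move=> i ia; rewrite dotvZl vF ?mulr0.
have [r r0 ru] := exists_rescaling u0 h2_gt0.
exists (r *: u), r^-1; split.
- by rewrite dotvZl dotvZr mulrA -expr2.
- have uu : 0 < dotv u u.
    by rewrite lt_def dotv_ge0 andbT; apply: contraNneq u0 => /dotv_eq0 ->.
  have r2 : 1 <= r ^+ 2.
    rewrite -(ler_pM2r uu) mul1r ru -hh -edist_sqr ler_sqr //.
    by rewrite nnegrE edist_ge0.
  rewrite invr_ge0 (ltW r0) invf_le1 //=.
  by rewrite -(expr_ge1 (n := 2)) // ltW.
- by rewrite scalerA mulVf ?scale1r // gt_eqF.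
- by move=> i ia; rewrite dotvZl uF ?mulr0.
Qed.

(** Every pyramid is a cone over a regular simplex: the apex is pushed along the
    axis, on the side where it already lies, up to the height of a regular
    simplex. *)
Lemma pyramidalK_cone (V : 'M[R]_(n, n.+1)) : pyramidalK V ->
  exists a W t, [/\ centered_simplex 1 W, 0 <= t <= 1 & V = cone a W t].
Proof.
move=> [a [/regular_simplex1P VF axis [h hh /andP[_ dh]] /barycenterT_eq0 V0]].
set F := (~: [set a])%SET in VF axis dh.
set b := barycenter V F in dh.
have [v [tau [vv t01 uE vF]]] := pyramid_axis axis hh dh.
rewrite -/F -/b in uE vF.
pose c := (n%:R + 1)^-1 *: v.
pose W := of_cols (fun j => (if j == a then v else col j V - b) - c).
have Wj j : j != a -> col j W = col j V - b - c by rewrite col_of_cols => /negPf ->.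
have Wa : col a W = v - c by rewrite col_of_cols eqxx.
have bE : b = - (n%:R^-1 *: col a V) by exact: barycenterC1.
have VaE : col a V = (n%:R / (n%:R + 1) * tau) *: v.
  rewrite -scalerA -uE bE opprK scalerDr !scalerA -scalerDl -[LHS]scale1r.
  by congr (_ *: _); field; rewrite ?n_neq0 ?nS_neq0.
have bvE : b = - ((tau / (n%:R + 1)) *: v).
  by rewrite bE VaE scalerA; congr (- (_ *: _)); field; rewrite ?n_neq0 ?nS_neq0.
exists a, W, (1 - tau); split; last 1 first.
- apply: eq_cols => j; have [->|ja] := eqVneq j a.
    rewrite col_cone_apex Wa VaE /c scalerBr scalerA -scalerBl.
    by congr (_ *: _); field.
  have -> : col j (cone a W (1 - tau)) = col j V - b - c + (c + b).
    rewrite col_cone // Wj // Wa; congr (_ + _).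
    rewrite bvE /c scalerBr scalerA -scaleNr -scalerBl -scalerDl.
    by congr (_ *: _); field; rewrite ?n_neq0 ?nS_neq0.
  by rewrite addrA !subrK.
- have Vb i : i != a -> dotv (col i V - b) (col i V - b) = 1 / 2 * (1 - n%:R^-1).
    move=> ia; rewrite (@dist_vertex_barycenter _ _ _ 1) ?cardsC1 ?card_ord //.
      by rewrite !inE ia mulr1n; field.
    move=> x y xF yF; apply: VF; [move: xF|move: yF]; rewrite !inE;
    by case/orP => [/eqP->|].
  have pyth i : i != a ->
      dotv (v - (col i V - b)) (v - (col i V - b)) = 1.
    move=> ia; rewrite dotvBl dotvBr (dotvBr v) (dotvC _ v) vF // vv Vb //.
    by field.
  split.
    move=> i j _ _ ij; rewrite !col_of_cols opprB addrA subrK.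
    have [ia|ia] := eqVneq i a; have [ja|ja] := eqVneq j a.
    + by rewrite ia ja eqxx in ij.
    + exact: pyth.
    + by rewrite -opprB dotvNl dotvNr opprK pyth.
    + by rewrite opprB addrA subrK VF // !inE.
  rewrite (bigD1 a) //= Wa (eq_bigr (fun j => col j V - (b + c))); last first.
    by move=> j ja; rewrite Wj // opprD addrA.
  rewrite sumrB sumr_const cardC1 card_ord.
  have /eqP := V0; rewrite (bigD1 a) //= addrC addr_eq0 => /eqP ->.
  have -> : v - c = (n%:R / (n%:R + 1)) *: v.
    rewrite -[X in X - _]scale1r -scalerBl; congr (_ *: _).
    by field; rewrite ?n_neq0 ?nS_neq0.
  have -> : b + c = ((1 - tau) / (n%:R + 1)) *: v.
    rewrite bvE -scaleNr -scalerDl; congr (_ *: _).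
    by field; rewrite ?n_neq0 ?nS_neq0.
  rewrite -(scaler_nat n (_ *: v)) scalerA VaE -opprD -scalerDl -scalerBl -[RHS](scale0r v).
  by congr (_ *: _); field; rewrite ?n_neq0 ?nS_neq0.
- by move/andP: t01 => [? ?]; lra.
Qed.

End SpaceK.

Section ConeRigidity.
Variables (R : realType) (n : nat).
Hypothesis n_ge2 : (2 <= n)%N.

Let n_neq0 : n%:R != 0 :> R. Proof. by rewrite pnatr_eq0 -lt0n ltnW. Qed.
Let nS_neq0 : n%:R + 1 != 0 :> R. Proof. by rewrite natr1 pnatr_eq0. Qed.
Let n_ge2R : 2 <= n%:R :> R. Proof. by rewrite ler_nat. Qed.

Lemma cone_norm a (W : 'M[R]_(n, n.+1)) t j : centered_simplex 1 W ->
  dotv (col j (cone a W t)) (col j (cone a W t)) =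
    if j == a then (1 - t) ^+ 2 * n%:R / (2 * (n%:R + 1))
    else (n%:R + ((1 - t) ^+ 2 - 1) / n%:R) / (2 * (n%:R + 1)).
Proof.
move=> Ws; have [->|ja] := eqVneq j a.
  rewrite col_cone_apex dotvZl dotvZr (centered_simplex_gram Ws) eqxx mulr1n.
  by rewrite -[n.+1%:R]natr1; field.
rewrite col_cone // !dotv_linear !(centered_simplex_gram Ws) !eqxx.
rewrite (eq_sym a) (negPf ja) mulr1n mulr0n -[n.+1%:R]natr1; field.
by rewrite n_neq0 nS_neq0.
Qed.

(** For t > 0 the apex is strictly nearer to the origin than the other vertices,
    and its distance to the origin determines t.  Algebraically, if the apexes
    differ then x = 1 - (1 - t)^2 and its analogue x' satisfy x' = n^2 x and
    x = n^2 x', so both vanish. *)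
Lemma cone_apex_height a a' (W W' : 'M[R]_(n, n.+1)) t t' :
  centered_simplex 1 W -> centered_simplex 1 W' ->
  0 <= t <= 1 -> 0 <= t' <= 1 -> cone a W t = cone a' W' t' ->
  t = t' /\ (t != 0 -> a = a').
Proof.
move=> Ws Ws' /andP[t0 t1] /andP[t'0 t'1] e.
have d_neq0 : (2 * (n%:R + 1))^-1 != 0 :> R.
  by rewrite invr_eq0 mulf_neq0 // pnatr_eq0.
have norm_eq j := etrans (etrans (esym (cone_norm a t j Ws))
  (congr1 (fun V => dotv (col j V) (col j V)) e)) (cone_norm a' t' j Ws').
have [aa'|aa'] := eqVneq a a'.
  split=> //; have := norm_eq a; rewrite aa' eqxx.
  move=> /(mulIf d_neq0)/(mulIf n_neq0)/eqP; rewrite eqrXn2 ?subr_ge0 // => /eqP.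
  by move=> /addrI/oppr_inj.
have := norm_eq a; rewrite eqxx (negPf aa') => /(mulIf d_neq0) ea.
have := norm_eq a'; rewrite eqxx eq_sym (negPf aa') => /(mulIf d_neq0) ea'.
pose x := 1 - (1 - t) ^+ 2; pose x' := 1 - (1 - t') ^+ 2.
have ex : x' = n%:R ^+ 2 * x.
  have -> : x' = n%:R * (n%:R - (n%:R + ((1 - t') ^+ 2 - 1) / n%:R)).
    by rewrite /x'; field.
  by rewrite -ea /x; ring.
have ex' : x = n%:R ^+ 2 * x'.
  have -> : x = n%:R * (n%:R - (n%:R + ((1 - t) ^+ 2 - 1) / n%:R)).
    by rewrite /x; field.
  by rewrite ea' /x'; ring.
have x0 : x = 0.
  have : (n%:R ^+ 4 - 1) * x = 0 by rewrite mulrBl mul1r {2}ex' ex; ring.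
  move=> /eqP; rewrite mulf_eq0 subr_eq0 => /orP[|/eqP //].
  by rewrite -natrX -[1]/(1%:R) eqr_nat; case: (n) n_ge2 => [|[|m]].
have x'0 : x' = 0 by rewrite ex x0 mulr0.
have t_0 : t = 0.
  have : t * (2 - t) = 0 by rewrite -x0 /x; ring.
  by move=> /eqP; rewrite mulf_eq0 => /orP[/eqP //|/eqP]; lra.
have t'_0 : t' = 0.
  have : t' * (2 - t') = 0 by rewrite -x'0 /x'; ring.
  by move=> /eqP; rewrite mulf_eq0 => /orP[/eqP //|/eqP]; lra.
by rewrite t_0 t'_0 eqxx.
Qed.

Lemma cone_inj a (W W' : 'M[R]_(n, n.+1)) t : t != 1 ->
  cone a W t = cone a W' t -> W = W'.
Proof.
move=> t1 e; have ea : col a W = col a W'.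
  apply: (@scalerI _ _ (1 - t)); first by rewrite subr_eq0 eq_sym.
  by rewrite -!col_cone_apex e.
apply: eq_cols => j; have [->//|ja] := eqVneq j a.
have : col j (cone a W t) = col j (cone a W' t) by rewrite e.
by rewrite !col_cone // ea => /addIr.
Qed.

Lemma cone0 a (W : 'M[R]_(n, n.+1)) : cone a W 0 = W.
Proof.
apply: eq_cols => j; have [->|ja] := eqVneq j a.
  by rewrite col_cone_apex subr0 scale1r.
by rewrite col_cone // mul0r scale0r addr0.
Qed.

End ConeRigidity.

Section PyramidalSpaceK.
Variables (R : realType) (n : nat) (ell : R) (D : 'M[R]_(n, n.+1)) (k : 'I_n.+1).
Hypothesis n_ge2 : (2 <= n)%N.
Hypothesis D_regular : regular_simplex ell D [set: 'I_n.+1]%SET.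
Hypothesis D_centered : barycenter D [set: 'I_n.+1]%SET = 0.

Local Notation E := (unit_frame ell D).
Local Notation stab :=
  (end_stabilizer (alt_facet D k) (alt_simplex D) (sym_facet D k)).

Let E_simplex : centered_simplex 1 E.
Proof. exact: unit_frame_simplex n_ge2 D_regular D_centered. Qed.

Let SO_simplex g : SO R n g -> centered_simplex 1 (g *m E).
Proof. by move=> [gg _]; exact: centered_simplex_mul. Qed.

Lemma cone_config g t : SO R n g -> unit_interval R t ->
  linear_embeddings R n n.+1 (n - 2) (g *m cone k E t) /\
  pyramidalK (g *m cone k E t).
Proof.
move=> /SO_simplex gs t01; rewrite mulmx_cone; split.
  exact: cone_embedding.
exact: cone_pyramidal.
Qed.

Lemma cone_onto V : pyramidalK V -> exists g t (s : 'S_n.+1),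
  [/\ SO R n g, unit_interval R t & V = col_perm s (g *m cone k E t)].
Proof.
move=> /(pyramidalK_cone n_ge2)[a [W [t [Ws t01 ->]]]].
pose s := tperm a k; pose W' := col_perm s W.
have Ws' : centered_simplex 1 W' by exact: centered_simplex_perm.
have [g [u [Sg uk W'E]]] := centered_simplex_SO (oner_neq0 R) k n_ge2 E_simplex Ws'.
exists g, t, (s * u)%g; split=> //.
have -> : cone a W t = col_perm s (cone k W' t).
  have {1}-> : k = s a by rewrite tpermL.
  by rewrite col_perm_cone /W' -col_permM tperm2 col_perm1.
by rewrite W'E -col_perm_cone uk mulmx_cone col_permM.
Qed.

Lemma cone_fiber g g' t t' (s : 'S_n.+1) :
  SO R n g -> SO R n g' -> unit_interval R t -> unit_interval R t' ->
  g *m cone k E t = col_perm s (g' *m cone k E t') ->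
  t = t' /\ exists2 h, stab t h & g = g' *m h.
Proof.
move=> Sg Sg' t01 t'01; rewrite !mulmx_cone => e.
pose a := (s^-1)%g k; have sa : s a = k by rewrite permKV.
have {}e : cone k (g *m E) t = cone a (col_perm s (g' *m E)) t'.
  by rewrite -col_perm_cone sa.
have gs := SO_simplex Sg; have gs' := centered_simplex_perm s (SO_simplex Sg').
have [tt' ka] := cone_apex_height n_ge2 gs gs' t01 t'01 e.
split=> //; rewrite -tt' in e.
have sk : t != 0 -> s k = k by move=> /ka {1}->.
have [t1|t1] := eqVneq t 1.
  have t0 : t != 0 by rewrite t1 oner_neq0.
  rewrite t1; apply: (same_facet_frame n_ge2 D_regular D_centered Sg Sg' (sk t0)) => i ik.
  have := congr1 (col i) e; rewrite -(ka t0) !col_cone // t1 div1r.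
  by rewrite !col_col_perm sk.
apply: (same_frame n_ge2 D_regular D_centered Sg Sg' t1 sk) => i.
rewrite -col_col_perm; congr (col i _).
have [t0|/ka ak] := eqVneq t 0; first by move: e; rewrite t0 !cone0.
by rewrite -ak in e; exact: cone_inj t1 e.
Qed.

Lemma cone_stab t h : unit_interval R t -> stab t h ->
  exists s : 'S_n.+1, h *m cone k E t = col_perm s (cone k E t).
Proof.
move=> _ hs; have [t1|t1] := eqVneq t 1.
  move: hs; rewrite t1 => /(stab1_frame n_ge2 D_regular D_centered)[s [e [sk _ _ hs]]].
  exists s; rewrite mulmx_cone -{2}sk col_perm_cone.
  apply: eq_cols => j; have [->|jk] := eqVneq j k.
    by rewrite !col_cone_apex subrr !scale0r.
  rewrite !col_cone // div1r !col_mulmx !col_col_perm sk -hs //.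
  by rewrite mulmxDr -scalemxAr.
have [s [sk hE]] := stab_frame n_ge2 D_regular D_centered hs t1.
have hsE : h *m E = col_perm s E.
  by apply: eq_cols => j; rewrite col_mulmx col_col_perm.
exists s; rewrite mulmx_cone hsE.
have [->|/sk sk'] := eqVneq t 0; first by rewrite !cone0.
by rewrite -col_perm_cone sk'.
Qed.

Theorem pyramidal_space_K_cylinder :
  homeomorphic (pyramidal_space_K R n) (pyramidal_cylinder D k).
Proof.
apply: (@orbit_space_cylinder R n n.+1 (n - 2) (@pyramidalK R n)
  (alt_facet D k) (alt_simplex D) (sym_facet D k) (cone k E)).
- exact: alt_facet_SO.
- exact: alt_facet_alt_simplex.
- exact: alt_facet_sym_facet n_ge2 D_regular D_centered.
- exact: cone_continuous.
- exact: cone_config.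
- exact: cone_onto.
- exact: cone_fiber.
- exact: cone_stab.
Qed.

End PyramidalSpaceK.

(** * Bipyramids over a regular simplex *)

Lemma ord0_lift_ind m (P : 'I_m.+1 -> Prop) :
  P ord0 -> (forall i, P (lift ord0 i)) -> forall j, P j.
Proof. by move=> P0 Pl j; case: (unliftP ord0 j) => [i ->|->]. Qed.

Section Bipyramid.
Variables (R : realType) (n : nat) (k : 'I_n.+1).
Hypothesis n_ge2 : (2 <= n)%N.
Implicit Types (W : 'M[R]_(n, n.+1)) (t : R).

Let n_gt0 : (0 < n)%N. Proof. exact: ltnW. Qed.
Let n_neq0 : n%:R != 0 :> R. Proof. by rewrite pnatr_eq0 -lt0n. Qed.
Let nS_neq0 : n%:R + 1 != 0 :> R. Proof. by rewrite natr1 pnatr_eq0. Qed.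
Let n_ge2R : 2 <= n%:R :> R. Proof. by rewrite ler_nat. Qed.

(** The regular simplex W with an additional point, labelled [ord0], on the axis
    through the vertex k.  It starts at the barycenter (t = 0), crosses the facet
    opposite to k and stops at the mirror image of the vertex k (t = 1); the shift
    by t / n recenters the configuration at the origin. *)
Definition bipyramid W t : 'M[R]_(n, n.+2) := of_cols (fun j =>
  if unlift ord0 j is Some i then col i W + (t / n%:R) *: col k W
  else - ((t * (n%:R + 1) / n%:R) *: col k W)).

Lemma col_bipyramid_apex W t :
  col ord0 (bipyramid W t) = - ((t * (n%:R + 1) / n%:R) *: col k W).
Proof. by rewrite col_of_cols unlift_none. Qed.

Lemma col_bipyramid W t i :
  col (lift ord0 i) (bipyramid W t) = col i W + (t / n%:R) *: col k W.
Proof. by rewrite col_of_cols liftK. Qed.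

Lemma mulmx_bipyramid (g : 'M[R]_n) W t :
  g *m bipyramid W t = bipyramid (g *m W) t.
Proof.
apply: eq_cols; elim/ord0_lift_ind => [|i]; rewrite col_mulmx.
  by rewrite !col_bipyramid_apex mulmxN col_mulmx -scalemxAr.
by rewrite !col_bipyramid mulmxDr -scalemxAr !col_mulmx.
Qed.

Lemma bipyramid_continuous W : continuous (bipyramid W).
Proof.
apply: continuous_into_matrix => i j.
pose p := if unlift ord0 j is Some l then W i l else 0.
pose q := if unlift ord0 j is Some l then W i k / n%:R
  else - (W i k * (n%:R + 1) / n%:R).
rewrite (_ : (fun t => _) = (fun t => p + t * q)); first exact: affine_continuous.
apply/funext => t; rewrite mxE /p /q; case: unlift => [l|]; rewrite !mxE; ring.
Qed.

(** As for the pyramids, up to a common shift only the additional point moves. *)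
Lemma bipyramid_mul W t (c : 'cV[R]_n.+2) : \sum_i c i 0 = 0 ->
  bipyramid W t *m c = W *m (\col_i c (lift ord0 i) 0 -
    (t * (n%:R + 2) / n%:R * c ord0 0) *: delta_mx k 0).
Proof.
rewrite big_ord_recl addrC => /eqP; rewrite addr_eq0 => /eqP cs.
rewrite mulmxBr -scalemxAr -colE !mulmx_cols big_ord_recl col_bipyramid_apex.
under eq_bigr do rewrite col_bipyramid scalerDr scalerA.
rewrite big_split /= -scaler_suml -mulr_suml cs.
under [X in _ = X - _]eq_bigr do rewrite mxE.
rewrite addrCA; congr (_ + _).
rewrite -(scaleNr _ (col k W)) -[RHS](scaleNr _ (col k W)) scalerA -scalerDl.
by congr (_ *: _); field.
Qed.

Section Config.
Variables (W : 'M[R]_(n, n.+1)) (t : R).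
Hypothesis W_simplex : centered_simplex 1 W.
Hypothesis t01 : 0 <= t <= 1.
Local Notation V := (bipyramid W t).
Local Notation w := (lift ord0 k).

Let gram i j : dotv (col i W) (col j W) = 1 / 2 * ((i == j)%:R - n.+1%:R^-1).
Proof. exact: centered_simplex_gram W_simplex _ _. Qed.

Let aw : ord0 != w. Proof. exact: neq_lift. Qed.

(** Every dependence expresses that the additional point is on the axis; it has
    equal coefficients on the n vertices of the facet. *)
Lemma bipyramid_embedding : linear_embeddings R n n.+2 (n - 2) V.
Proof.
have [t0 t1] := andP t01.
apply: (linear_embedding_of_dependences (B := (~: [set ord0; w])%SET)).
  have := cardsC [set ord0; w]%SET; rewrite cards2 aw card_ord.
  move=> /eqP; rewrite !eqSS => /eqP ->.
  by move: n_ge2; case: (n) => [|[|m]] // _; rewrite !subSS subn0.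
move=> c Vc c0; move: Vc; rewrite (bipyramid_mul _ _ c0).
move=> /(centered_simplex_kernel (oner_neq0 R) W_simplex) ker.
set b := (\sum_i _) / _ in ker.
have cb i : i != k -> c (lift ord0 i) 0 = b.
  by move=> ia; have := ker i; rewrite !mxE (negPf ia) /= mulr0 subr0.
have cw : c w 0 = b + t * (n%:R + 2) / n%:R * c ord0 0.
  by have := ker k; rewrite !mxE !eqxx /= mulr1 => /eqP; rewrite subr_eq => /eqP.
have ca : (1 + t * (n%:R + 2) / n%:R) * c ord0 0 = - ((n%:R + 1) * b).
  have := c0; rewrite big_ord_recl (bigD1 k) //= (eq_bigr (fun=> b)) //.
  rewrite sumr_const cardC1 card_ord cw -mulr_natl => /eqP.
  rewrite -[X in _ -> X]/(_ = _) => /eqP e; apply/eqP; rewrite -subr_eq0 -e.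
  by apply/eqP; ring.
have [b0|b0] := eqVneq b 0; [left|right].
  have {}ca : c ord0 0 = 0.
    move/eqP: ca; rewrite b0 mulr0 oppr0 mulf_eq0 => /orP[|/eqP //].
    rewrite gt_eqF // ltr_pwDl // divr_ge0 ?mulr_ge0 // addr_ge0 //.
  apply/colP; elim/ord0_lift_ind => [|i]; rewrite [RHS]mxE //.
  by have [->|/cb->//] := eqVneq i k; rewrite cw b0 ca mulr0 addr0.
exists b => // j; rewrite !inE negb_or.
by elim/ord0_lift_ind: j => [|i]; rewrite ?eqxx // (inj_eq lift_inj) => /andP[_ /cb].
Qed.

Lemma bipyramid_sum : \sum_j col j V = 0.
Proof.
rewrite big_ord_recl col_bipyramid_apex.
under eq_bigr do rewrite col_bipyramid.
rewrite big_split /= W_simplex.2 add0r sumr_const card_ord.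
rewrite -(scaler_nat n.+1 (_ *: _)) scalerA -(scaleNr _ (col k W)) -scalerDl.
rewrite -[RHS](scale0r (col k W)).
by congr (_ *: _); rewrite -[n.+1%:R]natr1; field.
Qed.

Let b : 'cV[R]_n := - (((1 - t) / n%:R) *: col k W).

Lemma bipyramid_barycenter : barycenter V (~: [set ord0; w])%SET = b.
Proof.
rewrite barycenterC2 ?bipyramid_sum // col_bipyramid_apex col_bipyramid /b.
congr (- _); rewrite -(scaleNr _ (col k W)) -[X in _ + (X + _)]scale1r.
by rewrite -!scalerDl scalerA; congr (_ *: _); field.
Qed.

Lemma bipyramid_axis : col ord0 V - b = ((1 - t * (n%:R + 2)) / n%:R) *: col k W.
Proof.
rewrite col_bipyramid_apex /b opprK -(scaleNr _ (col k W)) -scalerDl; congr (_ *: _).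
by field.
Qed.

Lemma bipyramid_top : col w V - b = ((n%:R + 1) / n%:R) *: col k W.
Proof.
rewrite col_bipyramid /b opprK -[X in X + _ + _]scale1r -!scalerDl; congr (_ *: _).
by field.
Qed.

Lemma bipyramid_Delta : (w |: ~: [set ord0; w] = ~: [set ord0])%SET.
Proof.
apply/setP => j; rewrite !inE negb_or.
by case: eqVneq => [->|_]; rewrite ?andbT // eq_sym aw.
Qed.

Let wk_sqr : dotv (col k W) (col k W) = n%:R / (2 * (n%:R + 1)).
Proof. by rewrite gram eqxx mulr1n -[n.+1%:R]natr1; field. Qed.

Let wk_gt0 : 0 < dotv (col k W) (col k W).
Proof. by rewrite wk_sqr divr_gt0 //; have := n_ge2R; lra. Qed.

Lemma bipyramid_equidistant : equidistant 1 V (~: [set ord0])%SET.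
Proof.
move=> i j; rewrite !inE; elim/ord0_lift_ind: i => [|i]; rewrite ?eqxx // => _.
elim/ord0_lift_ind: j => [|j]; rewrite ?eqxx // => _ ij.
rewrite !col_bipyramid opprD addrACA subrr addr0.
by apply: W_simplex.1; rewrite ?inE // -(inj_eq (@lift_inj _ ord0)).
Qed.

(** The regular simplex lies in the half-space bounded by the facet that contains
    the vertex k; this excludes the additional point once it has crossed. *)
Lemma bipyramid_hull_side x : hull V (~: [set ord0])%SET x ->
  0 <= dotv (x - b) (col k W).
Proof.
move=> [c [c0 c1 cA] <-].
have ca : c ord0 0 = 0 by apply: cA; rewrite !inE eqxx.
have c1' : \sum_i c (lift ord0 i) 0 = 1 by rewrite -c1 [RHS]big_ord_recl ca add0r.
have -> : V *m c - b = \sum_i c (lift ord0 i) 0 *: (col (lift ord0 i) V - b).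
  under eq_bigr do rewrite scalerBr.
  rewrite sumrB -scaler_suml c1' scale1r; congr (_ - _).
  by rewrite mulmx_cols big_ord_recl ca scale0r add0r.
rewrite dotv_suml; apply: sumr_ge0 => i _; rewrite dotvZl mulr_ge0 //.
have [->|ik] := eqVneq i k.
  by rewrite bipyramid_top dotvZl mulr_ge0 ?(ltW wk_gt0) // divr_ge0 //.
rewrite /b col_bipyramid opprK !dotv_linear !gram (negPf ik) eqxx.
rewrite mulr1n mulr0n -[n.+1%:R]natr1 le_eqVlt; apply/orP; left.
by apply/eqP; field; rewrite n_neq0 nS_neq0.
Qed.

Lemma bipyramid_pyramidal : pyramidalL V.
Proof.
have [t0 t1] := andP t01; have n2 := n_ge2R.
have n_pos : 0 < n%:R :> R by rewrite ltr0n.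
exists ord0, w; split; first exact: aw.
rewrite /= bipyramid_Delta bipyramid_barycenter.
rewrite (barycenterC1 _ bipyramid_sum).
have tn0 : 0 <= t * (n%:R + 2) by rewrite mulr_ge0 // addr_ge0.
have tn1 : t * (n%:R + 2) <= n%:R + 2 by rewrite ler_piMl // addr_ge0.
set l := (1 - t * (n%:R + 2)) / n%:R.
have axisE : col ord0 V - b = l *: col k W := bipyramid_axis.
split.
- split; apply/regular_simplex1P; last exact: bipyramid_equidistant.
  move=> i j; rewrite !inE !negb_or => /andP[i0 _] /andP[j0 _].
  by apply: bipyramid_equidistant; rewrite !inE.
- move=> i j; rewrite bipyramid_barycenter axisE !inE !negb_or.
  elim/ord0_lift_ind: i => [|i]; rewrite ?eqxx // (inj_eq lift_inj) => /andP[_ ik].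
  elim/ord0_lift_ind: j => [|j]; rewrite ?eqxx // (inj_eq lift_inj) => /andP[_ jk].
  rewrite !col_bipyramid opprD addrACA subrr addr0 !dotv_linear !gram.
  by rewrite (eq_sym k) (negPf ik) (eq_sym k) (negPf jk); ring.
- exists (edist (col k W) (- (n%:R^-1 *: col k W))).
    exact: unit_simplex_height_centered.
  rewrite edist_ge0 /= ler_sqrt ?dotv_ge0 // axisE opprK.
  have -> : col k W + n%:R^-1 *: col k W = ((n%:R + 1) / n%:R) *: col k W.
    by rewrite -[X in X + _]scale1r -scalerDl; congr (_ *: _); field.
  have sq x : dotv (x *: col k W) (x *: col k W) = x ^+ 2 * dotv (col k W) (col k W).
    by rewrite dotvZl dotvZr mulrA expr2.
  rewrite !sq ler_pM2r // -(real_normK (num_real l)) ler_pXn2r ?nnegrE ?divr_ge0 ?addr_ge0 //.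
  by rewrite ler_norml /l -mulNr !ler_pM2r ?invr_gt0 //; apply/andP; split; lra.
- have bD : - (n.+1%:R^-1 *: col ord0 V) = (t / n%:R) *: col k W.
    rewrite col_bipyramid_apex scalerN opprK scalerA; congr (_ *: _).
    by rewrite -[n.+1%:R]natr1; field; rewrite ?n_neq0 ?nS_neq0.
  rewrite bD; have [l0|l0] := leP 0 l.
  + have th : t * (n%:R + 2) <= 1.
      by rewrite -subr_ge0; move: l0; rewrite /l pmulr_lge0 ?invr_gt0.
    split=> [_|nhull].
      exists (t * (n%:R + 2)).
        by rewrite th andbT.
      rewrite -[LHS](subrK b) axisE /b -(scaleNr _ (col k W)) !scalerA -!scalerDl.
      by congr (_ *: _); rewrite /l; field.
    exfalso; apply: nhull.
    (* The point has barycentric coordinate s at the vertex k, and equal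
       coordinates at the vertices of the facet. *)
    pose s := l * n%:R / (n%:R + 1).
    have s0 : 0 <= s by apply: divr_ge0; [exact: mulr_ge0|exact: addr_ge0].
    have s1 : s <= 1.
      by rewrite /s /l divfK // ler_pdivrMr ?mul1r; lra.
    exists (\col_j (if j == ord0 then 0 else if j == w then s else (1 - s) / n%:R)).
      split.
      * move=> j; rewrite mxE; case: ifP => // _; case: ifP => // _.
        by rewrite divr_ge0 // subr_ge0.
      * rewrite big_ord_recl mxE eqxx add0r (bigD1 k) //= mxE eqxx.
        rewrite (eq_bigr (fun=> (1 - s) / n%:R)) => [|i ik]; last first.
          by rewrite mxE (inj_eq lift_inj) (negPf ik).
        by rewrite sumr_const cardC1 card_ord -[_ *+ n.+1.-1]mulr_natl /=; field.
      * by move=> j; rewrite !inE negbK mxE => ->.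
    rewrite mulmx_cols big_ord_recl mxE eqxx scale0r add0r (bigD1 k) //= mxE eqxx.
    rewrite (eq_bigr (fun i => ((1 - s) / n%:R) *: col (lift ord0 i) V)); last first.
      by move=> i ik; rewrite mxE (inj_eq lift_inj) (negPf ik).
    rewrite -scaler_sumr.
    have -> : \sum_(i < n.+1 | i != k) col (lift ord0 i) V = n%:R *: b.
      rewrite -bipyramid_barycenter (barycenterC2 aw bipyramid_sum).
      have /eqP := bipyramid_sum; rewrite big_ord_recl (bigD1 k) //= addrA addrC.
      by rewrite addr_eq0 => /eqP ->; rewrite scalerN scalerA mulfV // scale1r.
    rewrite scalerA divfK // -[RHS](subrK b) axisE.
    rewrite -[X in s *: X](subrK b) bipyramid_top scalerDr scalerA -addrA -scalerDl.
    rewrite (addrC s) subrK scale1r; congr (_ *: _ + _).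
    by rewrite /s; field; rewrite n_neq0 nS_neq0.
  + split=> [/bipyramid_hull_side|_].
      by rewrite axisE dotvZl pmulr_lge0 // leNgt l0.
    rewrite axisE bipyramid_top dotvZl dotvZr mulrA nmulr_rlt0 //.
    by rewrite nmulr_rlt0 // divr_gt0 // addr_gt0.
- exact/barycenterT_eq0/bipyramid_sum.
Qed.

End Config.
End Bipyramid.

Lemma fix_ord0_lift_perm m (s : 'S_m.+1) : s ord0 = ord0 ->
  exists u : 'S_m, s = lift_perm ord0 ord0 u.
Proof.
move=> s0; pose f i := odflt i (unlift ord0 (s (lift ord0 i))).
have fE i : lift ord0 (f i) = s (lift ord0 i).
  rewrite /f; case: (unliftP ord0 (s (lift ord0 i))) => [j ->|/eqP] //.
  by rewrite -{2}s0 (inj_eq (@perm_inj _ s)) eq_sym (negPf (neq_lift _ _)).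
have fI : injective f.
  by move=> i j /(congr1 (lift ord0)); rewrite !fE => /perm_inj/lift_inj.
exists (perm fI); apply/permP; elim/ord0_lift_ind => [|i].
  by rewrite lift_perm_id.
by rewrite lift_perm_lift permE fE.
Qed.

Section BipyramidRigidity.
Variables (R : realType) (n : nat) (k : 'I_n.+1).
Hypothesis n_ge2 : (2 <= n)%N.
Implicit Types (W : 'M[R]_(n, n.+1)) (t : R).

Let n_gt0 : (0 < n)%N. Proof. exact: ltnW. Qed.
Let n_neq0 : n%:R != 0 :> R. Proof. by rewrite pnatr_eq0 -lt0n. Qed.
Let n_pos : 0 < n%:R :> R. Proof. by rewrite ltr0n. Qed.
Let nS_neq0 : n%:R + 1 != 0 :> R. Proof. by rewrite natr1 pnatr_eq0. Qed.
Let n_ge2R : 2 <= n%:R :> R. Proof. by rewrite ler_nat. Qed.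

Local Notation w := (lift ord0 k).

Definition sqdist N (V : 'M[R]_(n, N)) i j : R :=
  dotv (col i V - col j V) (col i V - col j V).

Lemma sqdistC N (V : 'M[R]_(n, N)) i j : sqdist V i j = sqdist V j i.
Proof. by rewrite /sqdist -opprB dotvNl dotvNr opprK. Qed.

Lemma sqdist_apex_base W t i : centered_simplex 1 W -> i != k ->
  sqdist (bipyramid k W t) ord0 (lift ord0 i) =
  1 - (1 - t) * ((n%:R + 2) * (n%:R + t * (n%:R + 2)) / (2 * n%:R * (n%:R + 1))).
Proof.
move=> Ws ik; rewrite /sqdist col_bipyramid_apex col_bipyramid !dotv_linear.
rewrite !(centered_simplex_gram Ws) !eqxx (eq_sym k) (negPf ik) mulr1n mulr0n.
by rewrite -[n.+1%:R]natr1; field; rewrite n_neq0 nS_neq0.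
Qed.

Lemma sqdist_apex_top W t : centered_simplex 1 W ->
  sqdist (bipyramid k W t) ord0 w =
  (n%:R + t * (n%:R + 2)) ^+ 2 / (2 * n%:R * (n%:R + 1)).
Proof.
move=> Ws; rewrite /sqdist col_bipyramid_apex col_bipyramid !dotv_linear.
rewrite !(centered_simplex_gram Ws) !eqxx mulr1n.
by rewrite -[n.+1%:R]natr1; field; rewrite n_neq0 nS_neq0.
Qed.

Lemma sqdist_apex_top1 W : centered_simplex 1 W ->
  1 < sqdist (bipyramid k W 1) ord0 w.
Proof.
move=> Ws; rewrite (sqdist_apex_top _ Ws) mul1r.
have -> : (n%:R + (n%:R + 2)) ^+ 2 / (2 * n%:R * (n%:R + 1)) = 2 + 2 / n%:R :> R.
  by field; rewrite n_neq0 nS_neq0.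
by rewrite ltr_wpDr ?ltr1n // divr_ge0.
Qed.

Lemma sqdist_apex_base1 W i : centered_simplex 1 W -> i != k ->
  sqdist (bipyramid k W 1) ord0 (lift ord0 i) = 1.
Proof. by move=> Ws ik; rewrite sqdist_apex_base // subrr mul0r subr0. Qed.

Lemma sqdist_base W t i j : centered_simplex 1 W -> i != j ->
  sqdist (bipyramid k W t) (lift ord0 i) (lift ord0 j) = 1.
Proof.
by move=> Ws ij; apply: (bipyramid_equidistant k t Ws); rewrite ?inE //.
Qed.

(** The points of the regular simplex are at distance one from each other, and at
    t = 1 the additional point is at distance at least one from all of them. *)
Lemma sqdist_lt1 W t i j : centered_simplex 1 W -> 0 <= t <= 1 -> i != j ->
  sqdist (bipyramid k W t) i j < 1 -> t < 1 /\ (i = ord0 \/ j = ord0).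
Proof.
move=> Ws /andP[t0 t1].
have apex l : sqdist (bipyramid k W t) ord0 (lift ord0 l) < 1 -> t < 1.
  rewrite [t < 1]lt_def t1 andbT; apply: contraTN => /eqP <-.
  rewrite -leNgt; have [->|lk] := eqVneq l k; first exact/ltW/sqdist_apex_top1.
  by rewrite sqdist_apex_base1.
elim/ord0_lift_ind: i => [|i]; elim/ord0_lift_ind: j => [|j] ij.
- by rewrite eqxx in ij.
- by move=> /apex; split=> //; left.
- by rewrite sqdistC => /apex; split=> //; right.
- by rewrite sqdist_base ?ltxx // -(inj_eq (@lift_inj _ ord0)).
Qed.

Lemma sqdist_apex_lt1 W t i : centered_simplex 1 W -> 0 <= t -> t < 1 -> i != k ->
  sqdist (bipyramid k W t) ord0 (lift ord0 i) < 1.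
Proof.
move=> Ws t0 t1 ik; rewrite sqdist_apex_base // ltrBlDr ltrDl.
rewrite mulr_gt0 ?subr_gt0 // divr_gt0 ?mulr_gt0 ?ltr_pwDl ?mulr_ge0 ?addr_ge0 //.
Qed.

(** At t = 1 the two apexes are at twice the height of a regular simplex, and all
    the other distances are one. *)
Lemma sqdist_gt1 W i j : centered_simplex 1 W ->
  1 < sqdist (bipyramid k W 1) i j -> (i = ord0 /\ j = w) \/ (i = w /\ j = ord0).
Proof.
move=> Ws; have [->|ij] := eqVneq i j.
  by rewrite /sqdist subrr dotv0l ltNge ler01.
have apex l : 1 < sqdist (bipyramid k W 1) ord0 (lift ord0 l) -> l = k.
  by apply: contraPeq => lk; rewrite sqdist_apex_base1 // ltxx.
elim/ord0_lift_ind: i ij => [|i]; elim/ord0_lift_ind: j => [|j] ij.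
- by rewrite eqxx in ij.
- by move=> /apex ->; left.
- by rewrite sqdistC => /apex ->; right.
- by rewrite sqdist_base ?ltxx // -(inj_eq (@lift_inj _ ord0)).
Qed.

(** For t < 1 the additional point is at distance less than one from the at least
    two vertices of the facet.  Since such distances always involve the additional
    point, an isometric relabelling has to fix it. *)
Lemma bipyramid_apex_fixed W W' t t' (s : 'S_n.+2) :
  centered_simplex 1 W -> centered_simplex 1 W' ->
  0 <= t <= 1 -> 0 <= t' <= 1 -> t < 1 ->
  (forall i j, sqdist (bipyramid k W t) i j =
               sqdist (bipyramid k W' t') (s i) (s j)) ->
  t' < 1 /\ s ord0 = ord0.
Proof.
move=> Ws Ws' /andP[t0 _] t'01 t1 dist.
have short i : i != k -> t' < 1 /\ (s ord0 = ord0 \/ s (lift ord0 i) = ord0).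
  move=> ik; apply: (sqdist_lt1 Ws' t'01).
    by rewrite (inj_eq (@perm_inj _ s)) neq_lift.
  by rewrite -dist sqdist_apex_lt1.
pose i := lift k (Ordinal n_gt0); pose j := lift k (Ordinal n_ge2).
have ik : i != k by rewrite eq_sym neq_lift.
have jk : j != k by rewrite eq_sym neq_lift.
have [t'1 [//|si]] := short i ik; have [_ [//|sj]] := short j jk.
have : s (lift ord0 i) = s (lift ord0 j) by rewrite si sj.
by move=> /perm_inj/lift_inj/lift_inj/(congr1 val).
Qed.

Lemma col_perm_bipyramid (u : 'S_n.+1) W t :
  col_perm (lift_perm ord0 ord0 u) (bipyramid (u k) W t) =
  bipyramid k (col_perm u W) t.
Proof.
apply: eq_cols; elim/ord0_lift_ind => [|i]; rewrite col_col_perm.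
  by rewrite lift_perm_id !col_bipyramid_apex col_col_perm.
by rewrite lift_perm_lift !col_bipyramid !col_col_perm.
Qed.

(** The additional point is t (n + 1) / n times the opposite of the vertex k, so it
    determines t, the shift of the other points, and for t != 0 the vertex k. *)
Lemma bipyramid_inj a W W' t t' :
  centered_simplex 1 W -> centered_simplex 1 W' ->
  0 <= t <= 1 -> 0 <= t' <= 1 -> bipyramid k W t = bipyramid a W' t' ->
  [/\ t = t', W = W' & t != 0 -> k = a].
Proof.
move=> Ws Ws' /andP[t0 _] /andP[t'0 _] e.
have c_neq0 : (n%:R + 1) / n%:R != 0 :> R by rewrite mulf_neq0 // invr_eq0.
have apex : t *: col k W = t' *: col a W'.
  have := congr1 (col ord0) e; rewrite !col_bipyramid_apex => /oppr_inj e0.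
  have cE (x : R) (v : 'cV[R]_n) :
      (x * (n%:R + 1) / n%:R) *: v = ((n%:R + 1) / n%:R) *: (x *: v).
    by rewrite scalerA -mulrA mulrC.
  by apply: (scalerI c_neq0); rewrite -!cE.
have tt' : t = t'.
  have := congr1 (fun x => dotv x x) apex.
  rewrite !(dotvZl, dotvZr) (centered_simplex_gram Ws) (centered_simplex_gram Ws').
  rewrite !eqxx mulr1n; set c := _ / _ * _.
  have c0 : c != 0.
    rewrite (_ : c = n%:R / (n%:R + 1) / 2).
      by rewrite !mulf_neq0 // invr_eq0 // pnatr_eq0.
    by rewrite /c -[n.+1%:R]natr1; field.
  rewrite [LHS]mulrA [RHS]mulrA -!expr2 => /(mulIf c0)/eqP.
  by rewrite eqrXn2 // => /eqP.
rewrite -tt' in apex e *.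
have WW' : W = W'.
  apply: eq_cols => i; have := congr1 (col (lift ord0 i)) e.
  by rewrite !col_bipyramid mulrC -!scalerA apex => /addIr.
split=> // tn; apply: (centered_simplex_inj (oner_neq0 R) Ws).
by apply: (scalerI tn); rewrite apex WW'.
Qed.

End BipyramidRigidity.

Lemma perm_two_points (T : finType) (x y a b : T) : x != y -> a != b ->
  exists s : {perm T}, s x = a /\ s y = b.
Proof.
move=> xy ab; pose p := tperm x a; pose z := (p^-1)%g b.
have xz : x != z.
  by rewrite -(inj_eq (@perm_inj _ p)) permKV tpermL.
exists (tperm y z * p)%g; rewrite !permM; split.
  by rewrite tpermD ?tpermL // eq_sym.
by rewrite tpermL permKV.
Qed.

Section PyramidalL.
Variables (R : realType) (n : nat) (k : 'I_n.+1).
Hypothesis n_ge2 : (2 <= n)%N.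

Let n_gt0 : (0 < n)%N. Proof. exact: ltnW. Qed.
Let n_neq0 : n%:R != 0 :> R. Proof. by rewrite pnatr_eq0 -lt0n. Qed.
Let n_pos : 0 < n%:R :> R. Proof. by rewrite ltr0n. Qed.
Let nS_neq0 : n%:R + 1 != 0 :> R. Proof. by rewrite natr1 pnatr_eq0. Qed.
Let nSS_neq0 : n%:R + 2 != 0 :> R. Proof. by rewrite -natrD pnatr_eq0 addn2. Qed.

(** With a the moving point, w its opposite vertex and W the recentered regular
    simplex, the axis condition says a - b = l W_k for the barycenter b of F; the
    bound on the height is - (n + 1) <= n l, and the position of a relative to the
    simplex gives n l <= 1.  These are the bounds on t = (1 - n l) / (n + 2). *)
Lemma pyramidalL_bipyramid (V : 'M[R]_(n, n.+2)) : pyramidalL V ->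
  exists W t (s : 'S_n.+2), [/\ centered_simplex 1 W, 0 <= t <= 1 &
    col_perm s V = bipyramid k W t].
Proof.
move=> [a [w [aw]]] /=.
have Delta : (w |: ~: [set a; w] = ~: [set a])%SET.
  apply/setP => j; rewrite !inE negb_or.
  by case: eqVneq => [->|_]; rewrite ?andbT // eq_sym aw.
rewrite Delta => -[[_ /regular_simplex1P VD] axis [h hh /andP[_ dh]] [hullP nhullP]].
move=> /barycenterT_eq0 V0.
pose b : 'cV[R]_n := - (n%:R^-1 *: (col a V + col w V)).
pose bD : 'cV[R]_n := - (n.+1%:R^-1 *: col a V).
have bF : barycenter V (~: [set a; w])%SET = b by exact: barycenterC2.
have {}axis i j : i != a -> i != w -> j != a -> j != w ->
    dotv (col a V - b) (col i V - col j V) = 0.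
  by move=> ia iw ja jw; rewrite -bF; apply: axis; rewrite !inE negb_or ?ia ?ja.
move: dh hullP nhullP; rewrite bF (barycenterC1 a V0) -/bD => dh hullP nhullP.
have [s [s0 sk]] := perm_two_points (neq_lift ord0 k) aw.
pose c := n.+1%:R^-1 *: col a V.
pose W := of_cols (fun i => col (s (lift ord0 i)) V + c).
have WE i : col i W = col (s (lift ord0 i)) V + c by rewrite col_of_cols.
have sa i : s (lift ord0 i) != a.
  by rewrite -s0 (inj_eq (@perm_inj _ s)) eq_sym neq_lift.
have Ws : centered_simplex 1 W.
  split=> [i j _ _ ij|].
    rewrite !WE opprD addrACA subrr addr0.
    apply: VD; rewrite ?inE ?sa //.
    by rewrite (inj_eq (@perm_inj _ s)) (inj_eq lift_inj).
  under eq_bigr do rewrite WE.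
  rewrite big_split /= sumr_const card_ord /c -(scaler_nat n.+1 (_ *: _)) scalerA.
  rewrite mulfV ?pnatr_eq0 // scale1r addrC -[RHS]V0 (reindex_inj (@perm_inj _ s)).
  by rewrite [RHS]big_ord_recl s0.
have Vw : col w V = col k W - c by rewrite WE sk addrK.
have [l axisE] : exists l, col a V - b = l *: col k W.
  apply: (centered_simplex_perp (oner_neq0 R) Ws n_gt0) => i j ik jk.
  rewrite !WE opprD addrACA subrr addr0; by apply: axis;
    rewrite ?sa // -sk (inj_eq (@perm_inj _ s)) (inj_eq lift_inj).
have wk_sqr : dotv (col k W) (col k W) = n%:R / (2 * (n%:R + 1)).
  by rewrite (centered_simplex_gram Ws) eqxx mulr1n -[n.+1%:R]natr1; field.
have n1_pos : 0 < n%:R + 1 :> R by rewrite ltr_wpDl.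
have wk : 0 < dotv (col k W) (col k W) by rewrite wk_sqr divr_gt0 ?mulr_gt0.
have topE : col w V - b = ((n%:R + 1) / n%:R) *: col k W.
  rewrite /b Vw /c; move: (col a V) (col k W) => x y; apply/colP => i.
  by rewrite !mxE -[n.+1%:R]natr1; field; rewrite n_neq0 nS_neq0.
have bDE : bD - b = n%:R^-1 *: col k W.
  rewrite /bD /b Vw /c; move: (col a V) (col k W) => x y; apply/colP => i.
  by rewrite !mxE -[n.+1%:R]natr1; field; rewrite n_neq0 nS_neq0.
have lE : col a V = ((n%:R * l - 1) * (n%:R + 1) / (n%:R * (n%:R + 2))) *: col k W.
  move: axisE; rewrite /b Vw /c; move: (col a V) (col k W) => x y /colP e.
  apply/colP => i; have := e i; rewrite !mxE -[n.+1%:R]natr1 => ei.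
  have -> : (n%:R * l - 1) * (n%:R + 1) / (n%:R * (n%:R + 2)) * y i 0 =
      (n%:R + 1) / (n%:R + 2) * (l * y i 0 - y i 0 / n%:R).
    by field; rewrite n_neq0 nSS_neq0.
  by rewrite -ei; field; rewrite n_neq0 nS_neq0 nSS_neq0.
have l_ge : - (n%:R + 1) <= n%:R * l.
  have [h0 h2] := unit_simplex_height_sqr n_gt0 hh.
  have : edist (col a V) b ^+ 2 <= h ^+ 2 by rewrite ler_pXn2r ?nnegrE ?edist_ge0.
  rewrite edist_sqr axisE dotvZl dotvZr wk_sqr h2 mulrA -expr2.
  have -> : l ^+ 2 * (n%:R / (2 * (n%:R + 1))) =
      (n%:R * l) ^+ 2 / (2 * n%:R * (n%:R + 1)).
    by field; rewrite n_neq0 nS_neq0.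
  have -> : (n%:R + 1) / (2 * n%:R) =
      (n%:R + 1) ^+ 2 / (2 * n%:R * (n%:R + 1)) :> R.
    by field; rewrite n_neq0 nS_neq0.
  rewrite ler_pM2r ?invr_gt0 ?mulr_gt0 // -(real_normK (num_real (n%:R * l))).
  by rewrite ler_pXn2r ?nnegrE ?(ltW n1_pos) // ler_norml => /andP[].
have l_le : n%:R * l <= 1.
  have [ha|nha] := pselect (hull V (~: [set a])%SET (col a V)).
    have [tau /andP[t0 t1] tauE] := hullP ha.
    have : l *: col k W = ((1 - tau) / n%:R) *: col k W.
      rewrite -axisE -scalerA -bDE tauE scalerBr -addrA; congr (_ + _).
      by rewrite -[X in _ - X]scale1r -scalerBl -scaleNr; congr (_ *: _); ring.
    move=> /(congr1 (fun x => dotv x (col k W))); rewrite !dotvZl => /(mulIf (lt0r_neq0 wk)) ->.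
    by rewrite mulrC divfK //; lra.
  have := nhullP nha.
  rewrite axisE topE dotvZl dotvZr mulrA pmulr_llt0 // pmulr_llt0; last first.
    by rewrite divr_gt0 // ltr_wpDl.
  move=> l0; rewrite (le_trans _ ler01) // pmulr_rle0 // ltW //.
exists W, ((1 - n%:R * l) / (n%:R + 2)), s; split=> //.
  rewrite divr_ge0 ?subr_ge0 ?addr_ge0 //= ler_pdivrMr ?mul1r; have := n_pos; lra.
apply: eq_cols; elim/ord0_lift_ind => [|i]; rewrite col_col_perm.
  rewrite s0 col_bipyramid_apex lE -scaleNr; congr (_ *: _).
  by field; rewrite n_neq0 nSS_neq0.
rewrite col_bipyramid WE -addrA -[LHS]addr0; congr (_ + _).
rewrite /c lE scalerA -scalerDl -[LHS](scale0r (col k W)); congr (_ *: _).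
by rewrite -[n.+1%:R]natr1; field; rewrite n_neq0 nS_neq0 nSS_neq0.
Qed.

End PyramidalL.

Section PyramidalSpaceL.
Variables (R : realType) (n : nat) (ell : R) (D : 'M[R]_(n, n.+1)) (k : 'I_n.+1).
Hypothesis n_ge2 : (2 <= n)%N.
Hypothesis D_regular : regular_simplex ell D [set: 'I_n.+1]%SET.
Hypothesis D_centered : barycenter D [set: 'I_n.+1]%SET = 0.

Local Notation E := (unit_frame ell D).
Local Notation stab :=
  (end_stabilizer (alt_facet D k) (alt_simplex D) (sym_facet D k)).
Local Notation w := (lift ord0 k).

Let E_simplex : centered_simplex 1 E.
Proof. exact: unit_frame_simplex n_ge2 D_regular D_centered. Qed.

Let SO_simplex g : SO R n g -> centered_simplex 1 (g *m E).
Proof. by move=> [gg _]; exact: centered_simplex_mul. Qed.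

Let n_neq0 : n%:R != 0 :> R. Proof. by rewrite pnatr_eq0 -lt0n ltnW. Qed.

Lemma bipyramid_config g t : SO R n g -> unit_interval R t ->
  linear_embeddings R n n.+2 (n - 2) (g *m bipyramid k E t) /\
  pyramidalL (g *m bipyramid k E t).
Proof.
move=> /SO_simplex gs t01; rewrite mulmx_bipyramid; split.
  exact: bipyramid_embedding.
exact: bipyramid_pyramidal.
Qed.

Lemma bipyramid_onto V : pyramidalL V -> exists g t (s : 'S_n.+2),
  [/\ SO R n g, unit_interval R t & V = col_perm s (g *m bipyramid k E t)].
Proof.
move=> /(pyramidalL_bipyramid k n_ge2)[W [t [s [Ws t01 VE]]]].
have [g [u [Sg uk W'E]]] := centered_simplex_SO (oner_neq0 R) k n_ge2 E_simplex Ws.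
exists g, t, (s^-1 * lift_perm ord0 ord0 u)%g; split=> //.
rewrite col_permM mulmx_bipyramid -{1}uk col_perm_bipyramid -W'E -VE.
by rewrite -col_permM mulVg col_perm1.
Qed.

Lemma bipyramid_fiber g g' t t' (s : 'S_n.+2) :
  SO R n g -> SO R n g' -> unit_interval R t -> unit_interval R t' ->
  g *m bipyramid k E t = col_perm s (g' *m bipyramid k E t') ->
  t = t' /\ exists2 h, stab t h & g = g' *m h.
Proof.
move=> Sg Sg' t01 t'01; rewrite !mulmx_bipyramid => e.
have gs := SO_simplex Sg; have gs' := SO_simplex Sg'.
have dist i j : sqdist (bipyramid k (g *m E) t) i j =
    sqdist (bipyramid k (g' *m E) t') (s i) (s j).
  by rewrite e /sqdist !col_col_perm.
have distV i j : sqdist (bipyramid k (g' *m E) t') i j =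
    sqdist (bipyramid k (g *m E) t) ((s^-1)%g i) ((s^-1)%g j).
  by rewrite dist !permKV.
have [t1|t1] := eqVneq t 1; last first.
  have [|t'1 s0] := bipyramid_apex_fixed n_ge2 gs gs' t01 t'01 _ dist.
    by rewrite lt_def eq_sym t1; case/andP: t01.
  have [u su] := fix_ord0_lift_perm s0.
  pose a := (u^-1)%g k; have ua : u a = k by rewrite permKV.
  have {}e : bipyramid k (g *m E) t = bipyramid a (col_perm u (g' *m E)) t'.
    by rewrite -col_perm_bipyramid ua -su.
  have [tt' WW' ka] := bipyramid_inj n_ge2 gs (centered_simplex_perm u gs') t01 t'01 e.
  split=> //; apply: (same_frame n_ge2 D_regular D_centered Sg Sg' (s := u)) => //.
    by move=> /ka {1}->.
  by move=> i; rewrite WW' col_col_perm.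
have t'1 : t' = 1.
  apply/eqP/negPn/negP => t'1.
  have [|] := bipyramid_apex_fixed n_ge2 gs' gs t'01 t01 _ distV.
    by rewrite lt_def eq_sym t'1; case/andP: t'01.
  by rewrite t1 ltxx.
split; first by rewrite t1.
rewrite t1 t'1 in e dist *.
have ends : (s ord0 = ord0 /\ s w = w) \/ (s ord0 = w /\ s w = ord0).
  by apply: (sqdist_gt1 n_ge2 gs'); rewrite -dist; exact: sqdist_apex_top1.
(* If s exchanges the two apexes, compose it with their transposition. *)
have [u [uk us]] : exists u : 'S_n.+1, u k = k /\
    forall i, i != k -> lift ord0 (u i) = s (lift ord0 i).
  pose v := if s ord0 == ord0 then s else (s * tperm ord0 w)%g.
  have v0 : v ord0 = ord0.
    rewrite /v; case: eqP => // s0; rewrite permM.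
    by case: ends => -[e0 _]; [|rewrite e0 tpermR].
  have vw : v w = w.
    rewrite /v; case: eqP => s0; case: ends => -[e0 ew] //.
      by have := neq_lift ord0 k; rewrite -e0 s0 eqxx.
    by rewrite permM ew tpermL.
  have vs i : i != k -> v (lift ord0 i) = s (lift ord0 i).
    move=> ik; rewrite /v; case: eqP => // s0.
    case: ends => -[e0 ew] //; rewrite permM tpermD //.
      by rewrite -{1}ew (inj_eq (@perm_inj _ s)) (inj_eq lift_inj) eq_sym.
    by rewrite -{1}e0 (inj_eq (@perm_inj _ s)) neq_lift.
  have [u vu] := fix_ord0_lift_perm v0; exists u; split=> [|i ik].
    by apply: (@lift_inj _ ord0); rewrite -(lift_perm_lift ord0 ord0) -vu.
  by rewrite -vs // vu lift_perm_lift.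
apply: (same_facet_frame n_ge2 D_regular D_centered Sg Sg' uk) => i ik.
have := congr1 (col (lift ord0 i)) e.
by rewrite col_col_perm -us // !col_bipyramid div1r.
Qed.

Lemma bipyramid_stab t h : unit_interval R t -> stab t h ->
  exists s : 'S_n.+2, h *m bipyramid k E t = col_perm s (bipyramid k E t).
Proof.
move=> _ hs; have [t1|t1] := eqVneq t 1; last first.
  have [u [uk hE]] := stab_frame n_ge2 D_regular D_centered hs t1.
  have hsE : h *m E = col_perm u E.
    by apply: eq_cols => j; rewrite col_mulmx col_col_perm.
  exists (lift_perm ord0 ord0 u); rewrite mulmx_bipyramid hsE.
  have [t0|/uk uk'] := eqVneq t 0; last by rewrite -{2}uk' col_perm_bipyramid.
  apply: eq_cols; elim/ord0_lift_ind => [|i]; rewrite col_col_perm.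
    by rewrite lift_perm_id !col_bipyramid_apex t0 !mul0r !scale0r.
  by rewrite lift_perm_lift !col_bipyramid t0 !mul0r !scale0r !addr0 col_col_perm.
move: hs; rewrite t1 => /(stab1_frame n_ge2 D_regular D_centered).
move=> [u [e [uk e1 hk hB]]].
have topE : col w (bipyramid k E 1) = ((n%:R + 1) / n%:R) *: col k E.
  rewrite col_bipyramid -[X in X + _]scale1r -scalerDl; congr (_ *: _).
  by field.
have apexE : col ord0 (bipyramid k E 1) = - (((n%:R + 1) / n%:R) *: col k E).
  by rewrite col_bipyramid_apex mul1r.
have baseE i : i != k -> h *m col (lift ord0 i) (bipyramid k E 1) =
    col (lift ord0 (u i)) (bipyramid k E 1).
  by move=> ik; rewrite !col_bipyramid div1r hB.
case: e1 => e1; rewrite e1 in hk.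
  exists (lift_perm ord0 ord0 u); apply: eq_cols; elim/ord0_lift_ind => [|i];
    rewrite col_col_perm col_mulmx ?lift_perm_id ?lift_perm_lift.
    by rewrite apexE mulmxN -scalemxAr hk scale1r.
  have [->|/baseE//] := eqVneq i k.
  by rewrite uk topE -scalemxAr hk scale1r.
(* A rotation that reverses the axis exchanges the two apexes. *)
exists (lift_perm ord0 ord0 u * tperm ord0 w)%g.
apply: eq_cols; elim/ord0_lift_ind => [|i];
  rewrite col_col_perm col_mulmx permM ?lift_perm_id ?lift_perm_lift.
  by rewrite tpermL apexE topE mulmxN -scalemxAr hk scaleN1r scalerN opprK.
have [->|ik] := eqVneq i k.
  by rewrite uk tpermR apexE topE -scalemxAr hk scaleN1r scalerN.
rewrite tpermD ?baseE ?neq_lift // (inj_eq lift_inj) -{1}uk.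
by rewrite (inj_eq (@perm_inj _ u)) eq_sym.
Qed.

Theorem pyramidal_space_L_cylinder :
  homeomorphic (pyramidal_space_L R n) (pyramidal_cylinder D k).
Proof.
apply: (@orbit_space_cylinder R n n.+2 (n - 2) (@pyramidalL R n)
  (alt_facet D k) (alt_simplex D) (sym_facet D k) (bipyramid k E)).
- exact: alt_facet_SO.
- exact: alt_facet_alt_simplex.
- exact: alt_facet_sym_facet n_ge2 D_regular D_centered.
- exact: bipyramid_continuous.
- exact: bipyramid_config.
- exact: bipyramid_onto.
- exact: bipyramid_fiber.
- exact: bipyramid_stab.
Qed.

End PyramidalSpaceL.

Theorem proposition2p1 (R : realType) (n : nat) (n_ge2 : (2 <= n)%N)
    (ell : R) (D : 'M[R]_(n, n.+1)) (k : 'I_n.+1)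
    (D_regular : regular_simplex ell D [set: 'I_n.+1]%SET)
    (D_centered : barycenter D [set: 'I_n.+1]%SET = 0) :
  homeomorphic (pyramidal_space_K R n) (pyramidal_cylinder D k) /\
  homeomorphic (pyramidal_space_L R n) (pyramidal_cylinder D k).
Proof.
split; first exact: pyramidal_space_K_cylinder n_ge2 D_regular D_centered.
exact: pyramidal_space_L_cylinder n_ge2 D_regular D_centered.
Qed.
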